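(* If $k(x)/k$ is a purely transcendental extension of degree $1$ over a flexible field $k$ of characteristic different from $2$, then $\mathrm{k}^M_p(k(x)/k)\cong0$ for $p\ge2$. In particular, $\mathrm{k}^M_*(k(x)/k)$ is a Koszul algebra.
   Context: A field $k$ is flexible if $k=k_0(t_1,t_2,\dots)$ is a purely transcendental extension of infinite degree of some field $k_0$. Purely transcendental of degree $1$ means of transcendence degree $1$. $\mathrm{k}^M_*(F)$ is the mod 2 Milnor K-theory of a field $F$; a pure symbol is an element $\{a_1,\dots,a_n\}$. For a finitely generated field extension $F/k$, the isotropic Milnor K-theory $\mathrm{k}^M_*(F/k)$ is the quotient of $\mathrm{k}^M_*(F)$ by the ideal defined as the union of the annihilators of the images of non-zero pure symbols from $\mathrm{k}^M_*(k)$. Koszul algebras: for an $\mathbb{F}_2$-vector space $V$ and $R\subseteq V\otimes V$, the quadratic algebra is $A=T(V)/(R)$, and its Koszul dual coalgebra $A^{¡}$ is the subcoalgebra of the tensor coalgebra $T^c(V)$ given by $\mathbb{F}_2\oplus V\oplus R\oplus\cdots\oplus\big(\bigcap_{i+j=n-2}V^{\otimes i}\otimes R\otimes V^{\otimes j}\big)\oplus\cdots$. A quadratic algebra $A$ is Koszul if there is an isomorphism of coalgebras $A^{¡}\cong\mathrm{Tor}^A_*(\mathbb{F}_2,\mathbb{F}_2)$. *)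

(* Defs.v *)
From HB Require Import structures.
From mathcomp Require Import all_boot all_order all_algebra.
From mathcomp Require Import boolp.
From mathcomp Require Import finmap ring_quotient.
From mathcomp Require Import multinomials.mpoly multinomials.monalg.

Set Implicit Arguments.
Unset Strict Implicit.
Unset Printing Implicit Defensive.

Import GRing.Theory.
Local Open Scope ring_scope.
Local Open Scope quotient_scope.

(* Vector spaces over F_2 are handled as additive groups of exponent 2: for
   these, F_2-linear maps, subspaces and spans are the same as additive maps,
   subgroups and generated subgroups. *)

Section Span.
Variables (M : zmodType) (S : M -> Prop).

Inductive zspan : M -> Prop :=
| zspan0 : zspan 0
| zspan_gen x : S x -> zspan x
| zspanB x y : zspan x -> zspan y -> zspan (x - y).

Definition span_pred : {pred M} := fun x => `[< zspan x >].

Lemma span_predP x : reflect (zspan x) (x \in span_pred).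
Proof. exact: asboolP. Qed.

Lemma span_pred_zmod_closed : zmod_closed span_pred.
Proof.
split; first exact/span_predP/zspan0.
by move=> x y /span_predP sx /span_predP sy; apply/span_predP/zspanB.
Qed.

HB.instance Definition _ := GRing.isZmodClosed.Build M span_pred
  span_pred_zmod_closed.

Definition sub_span := {x : M | x \in span_pred}.
HB.instance Definition _ := SubChoice.on sub_span.
HB.instance Definition _ := [SubChoice_isSubZmodule of sub_span by <:].
End Span.

(* Quotients, sealed so that unification does not unfold their operations. *)

Record quotient (M : zmodType) (S : M -> Prop) := MkQuotient {
  quotient_sort : zmodType;
  quotient_pi : {additive M -> quotient_sort};
  quotient_repr : quotient_sort -> M;
  quotient_reprK : cancel quotient_repr quotient_pi;
  quotient_eq0 : forall x, quotient_pi x = 0 <-> zspan S x }.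

Fact quotient_exists (M : zmodType) (S : M -> Prop) : quotient S.
Proof.
pose Q := Quotient.quot (span_pred S).
apply: (@MkQuotient M S Q \pi_Q repr) => [|x]; first exact: reprK.
have E : (x \in span_pred S) = (\pi_Q x == 0).
  by rewrite -{1}[x]subr0 (Quotient.idealrBE (span_pred S)) raddf0.
split=> [/eqP|/span_predP]; first by rewrite -E => /span_predP.
by rewrite E => /eqP.
Qed.

Section QuotSpan.
Variables (M : zmodType) (S : M -> Prop).

Definition quot_span : zmodType := quotient_sort (quotient_exists S).
Definition to_quot : {additive M -> quot_span} := quotient_pi (quotient_exists S).
Definition quot_repr : quot_span -> M := @quotient_repr _ _ (quotient_exists S).

Lemma quot_reprK : cancel quot_repr to_quot.
Proof. exact: quotient_reprK. Qed.

Lemma to_quot_eq0 x : to_quot x = 0 <-> zspan S x.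
Proof. exact: quotient_eq0. Qed.

Lemma to_quot_eq x y : to_quot x = to_quot y <-> zspan S (x - y).
Proof.
rewrite -to_quot_eq0 raddfB; split=> [->|/eqP]; first exact: subrr.
by rewrite subr_eq0 => /eqP.
Qed.
End QuotSpan.

Section Ideal.
Variables (A : pzRingType) (S : A -> Prop).

Definition ideal_gens (z : A) : Prop := exists a s b, S s /\ z = a * s * b.

(* The two-sided ideal generated by S. *)
Definition ideal (z : A) : Prop := zspan ideal_gens z.

Lemma idealMl a z : ideal z -> ideal (a * z).
Proof.
elim=> [|_ [b [s [c [Ss ->]]]]|x y _ Ix _ Iy].
- by rewrite mulr0; apply: zspan0.
- by apply: zspan_gen; exists (a * b), s, c; rewrite !mulrA.
- by rewrite mulrBr; apply: zspanB.
Qed.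

Lemma idealMr a z : ideal z -> ideal (z * a).
Proof.
elim=> [|_ [b [s [c [Ss ->]]]]|x y _ Ix _ Iy].
- by rewrite mul0r; apply: zspan0.
- by apply: zspan_gen; exists b, s, (c * a); rewrite !mulrA.
- by rewrite mulrBl; apply: zspanB.
Qed.
End Ideal.

Record ring_quotient (A : pzRingType) (S : A -> Prop) := MkRingQuotient {
  ring_quotient_sort : pzRingType;
  ring_quotient_pi : {rmorphism A -> ring_quotient_sort};
  ring_quotient_repr : ring_quotient_sort -> A;
  ring_quotient_reprK : cancel ring_quotient_repr ring_quotient_pi;
  ring_quotient_eq0 : forall x, ring_quotient_pi x = 0 <-> ideal S x }.

Section RingQuotientExists.
Variables (A : pzRingType) (S : A -> Prop).

Let p : {additive A -> quot_span (ideal_gens S)} := to_quot (ideal_gens S).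

Lemma quot_span_ind (P : quot_span (ideal_gens S) -> Prop) :
  (forall x, P (p x)) -> forall z, P z.
Proof. by move=> Px z; rewrite -[z]quot_reprK; apply: Px. Qed.

Definition quot_mul (x y : quot_span (ideal_gens S)) : quot_span (ideal_gens S) :=
  p (quot_repr x * quot_repr y).

Lemma to_quotM x y : p (x * y) = quot_mul (p x) (p y).
Proof.
apply/to_quot_eq; set x' := quot_repr _; set y' := quot_repr _.
have Ix : ideal S (x - x') by apply/to_quot_eq; rewrite quot_reprK.
have Iy : ideal S (y - y') by apply/to_quot_eq; rewrite quot_reprK.
rewrite -(subrK (x * y') (x * y)) -mulrBr -addrA -mulrBl -[_ * y']opprK.
apply: zspanB; first exact: idealMl.
by rewrite -sub0r; apply: zspanB; [apply: zspan0 | apply: idealMr].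
Qed.

Fact quot_mulA : associative quot_mul.
Proof.
elim/quot_span_ind=> x; elim/quot_span_ind=> y; elim/quot_span_ind=> z.
by rewrite -!to_quotM mulrA.
Qed.

Fact quot_mul1q : left_id (p 1) quot_mul.
Proof. by elim/quot_span_ind=> x; rewrite -to_quotM mul1r. Qed.

Fact quot_mulq1 : right_id (p 1) quot_mul.
Proof. by elim/quot_span_ind=> x; rewrite -to_quotM mulr1. Qed.

Fact quot_mulDl : left_distributive quot_mul +%R.
Proof.
elim/quot_span_ind=> x; elim/quot_span_ind=> y; elim/quot_span_ind=> z.
by rewrite -raddfD -!to_quotM mulrDl raddfD.
Qed.

Fact quot_mulDr : right_distributive quot_mul +%R.
Proof.
elim/quot_span_ind=> x; elim/quot_span_ind=> y; elim/quot_span_ind=> z.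
by rewrite -raddfD -!to_quotM mulrDr raddfD.
Qed.

Definition quot_ring : Type := quot_span (ideal_gens S).
HB.instance Definition _ := GRing.Zmodule.on quot_ring.
HB.instance Definition _ := GRing.Zmodule_isPzRing.Build quot_ring
  quot_mulA quot_mul1q quot_mulq1 quot_mulDl quot_mulDr.

Definition to_quot_ring : A -> quot_ring := p.
HB.instance Definition _ := GRing.isZmodMorphism.Build A quot_ring to_quot_ring
  (raddfB p).
Fact to_quot_ring_monoid_morphism : monoid_morphism to_quot_ring.
Proof. by split=> // x y; apply: to_quotM. Qed.
HB.instance Definition _ := GRing.isMonoidMorphism.Build A quot_ring to_quot_ring
  to_quot_ring_monoid_morphism.

Fact ring_quotient_exists : ring_quotient S.
Proof.
apply: (@MkRingQuotient A S quot_ring to_quot_ring (@quot_repr _ _)).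
  exact: quot_reprK.
exact: to_quot_eq0.
Qed.
End RingQuotientExists.

Section RingQuot.
Variables (A : pzRingType) (S : A -> Prop).

Definition ring_quot : pzRingType := ring_quotient_sort (ring_quotient_exists S).
Definition to_rquot : {rmorphism A -> ring_quot} :=
  ring_quotient_pi (ring_quotient_exists S).
Definition rquot_repr : ring_quot -> A :=
  @ring_quotient_repr _ _ (ring_quotient_exists S).

Lemma rquot_reprK : cancel rquot_repr to_rquot.
Proof. exact: ring_quotient_reprK. Qed.

Lemma to_rquot_eq0 x : to_rquot x = 0 <-> ideal S x.
Proof. exact: ring_quotient_eq0. Qed.

Lemma to_rquot_eq x y : to_rquot x = to_rquot y <-> ideal S (x - y).
Proof.
rewrite -to_rquot_eq0 rmorphB; split=> [->|e]; first exact: subrr.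
by apply/eqP; rewrite -subr_eq0; apply/eqP.
Qed.

Lemma to_rquot_ind (P : ring_quot -> Prop) :
  (forall x, P (to_rquot x)) -> forall z, P z.
Proof. by move=> Px z; rewrite -[z]rquot_reprK; apply: Px. Qed.
End RingQuot.

(* gen_deg e n is the span of the n-fold products of values of e: the degree n
   part of a ring generated by elements e x of degree 1. *)
Definition gen_deg (X : Type) (B : pzRingType) (e : X -> B) (n : nat) : B -> Prop :=
  zspan (fun z => exists s : seq X, size s = n /\ z = \prod_(x <- s) e x).

(* The free associative F_2-algebra on X. *)
Definition free_alg (X : choiceType) := {malg 'F_2[{fmonom X}]}.
HB.instance Definition _ X := GRing.NzRing.on (free_alg X).
Definition letter (X : choiceType) (x : X) : free_alg X := mkmalgU (fmu x) 1.

(* F_2-linear extension to a free F_2-module of a map on its basis: an element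
   of {malg 'F_2[X]} is the sum of the basis elements in its support. *)
Definition ext2 (X : choiceType) (W : zmodType) (f : X -> W)
  (g : {malg 'F_2[X]}) : W := \sum_(x <- msupp g) f x.

Section Ext2.
Variables (X : choiceType) (W : zmodType) (f : X -> W).
Hypothesis W2 : forall w : W, w + w = 0.

Lemma F2_natP (c : 'F_2) : c = (c != 0)%:R.
Proof. by case: c => [[|[|?]] ?] //; apply: val_inj. Qed.

Lemma ext2Ew (d : {fset X}) g : (msupp g `<=` d)%fset ->
  ext2 f g = \sum_(x <- d) f x *+ (mcoeff x g != 0).
Proof.
move=> le; rewrite /ext2 -(big_fset_incl _ le) /=; last first.
  by move=> x xd; rewrite -mcoeff_eq0 => ->; rewrite mulr0n.
by rewrite big_seq [RHS]big_seq; apply: eq_bigr => x; rewrite -mcoeff_neq0 => ->.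
Qed.

Lemma ext2_zmod_morphism : zmod_morphism (ext2 f).
Proof.
move=> g h; have le := msuppB_le g h.
rewrite (ext2Ew le) (ext2Ew (fsubsetUl (msupp g) (msupp h))).
rewrite (ext2Ew (fsubsetUr (msupp g) (msupp h))) -sumrB.
apply: eq_bigr => x _; rewrite mcoeffB.
have N2 : - f x = f x by apply/eqP; rewrite eq_sym -addr_eq0 W2.
by case: (mcoeff x g) => [[|[|?]] ?] //; case: (mcoeff x h) => [[|[|?]] ?] //;
  rewrite ?subrr ?sub0r ?subr0 ?N2.
Qed.

Lemma ext2U x : ext2 f (mkmalgU x 1) = f x.
Proof. by rewrite /ext2 msuppU oner_eq0 big_seq_fset1. Qed.
End Ext2.

Lemma malg2_ind (X : choiceType) (P : {malg 'F_2[X]} -> Prop) :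
  P 0 -> (forall x g, P g -> P (mkmalgU x 1 + g)) -> forall g, P g.
Proof.
move=> P0 PD g; rewrite [g]monalgE; elim: (enum_fset (msupp g)) => [|x r IH].
  by rewrite big_nil.
rewrite big_cons [mcoeff x g]F2_natP.
by case: (_ != 0); [apply: PD | rewrite monalgU0 add0r].
Qed.

(* The tensor product over F_2. *)
Section Tensor.
Variables U W : zmodType.

Definition tensor_rel (z : {malg 'F_2[(U * W)%type]}) : Prop :=
  (exists u u' w, z = mkmalgU (u + u', w) 1 - mkmalgU (u, w) 1
                      - mkmalgU (u', w) 1) \/
  (exists u w w', z = mkmalgU (u, w + w') 1 - mkmalgU (u, w) 1
                      - mkmalgU (u, w') 1).

Definition tensor : zmodType := quot_span tensor_rel.

Definition tens (u : U) (w : W) : tensor := to_quot tensor_rel (mkmalgU (u, w) 1).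

Definition tensor_lift (X : zmodType) (f : U -> W -> X) (z : tensor) : X :=
  ext2 (fun p => f p.1 p.2) (quot_repr z).
End Tensor.

Section TensorLift.
Variables (U W X : zmodType) (f : U -> W -> X).
Hypothesis X2 : forall x : X, x + x = 0.
Hypothesis fDl : forall u u' w, f (u + u') w = f u w + f u' w.
Hypothesis fDr : forall u w w', f u (w + w') = f u w + f u w'.

Let F := ext2 (fun p : U * W => f p.1 p.2).

Lemma tensor_lift_to_quot g : tensor_lift f (to_quot _ g) = F g.
Proof.
have FB := ext2_zmod_morphism (fun p : U * W => f p.1 p.2) X2.
apply/eqP; rewrite -subr_eq0 -FB; apply/eqP.
have : zspan (@tensor_rel U W) (quot_repr (to_quot (@tensor_rel U W) g) - g).
  by apply/to_quot_eq; rewrite quot_reprK.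
elim=> [|_ [] [a [b [c ->]]]|x y _ Ix _ Iy].
- by rewrite -(subrr 0) FB subrr.
- by rewrite !FB !ext2U /= fDl addrAC addrK subrr.
- by rewrite !FB !ext2U /= fDr addrAC addrK subrr.
- by rewrite FB Ix Iy subrr.
Qed.

Lemma tensor_lift_zmod_morphism : zmod_morphism (tensor_lift f).
Proof.
move=> x y; rewrite -[x]quot_reprK -[y]quot_reprK -raddfB !tensor_lift_to_quot.
exact: ext2_zmod_morphism.
Qed.

Lemma tensor_lift_tens u w : tensor_lift f (tens u w) = f u w.
Proof. by rewrite tensor_lift_to_quot /F ext2U. Qed.
End TensorLift.

(* The tensor algebra over F_2; gen_deg (@tgen V) n is the n-th tensor power. *)
Section TensorAlgebra.
Variable V : zmodType.

Definition additive_rel (z : free_alg V) : Prop :=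
  exists v w, z = letter (v + w) - letter v - letter w.

Definition tensor_alg : pzRingType := ring_quot additive_rel.

Definition tgen (v : V) : tensor_alg := to_rquot additive_rel (letter v).

Definition word (s : seq V) : tensor_alg := \prod_(v <- s) tgen v.

Definition tensor_alg_lift (W : zmodType) (f : seq V -> W) (z : tensor_alg) : W :=
  ext2 (fun m : {fmonom V} => f (fmonom_val m)) (rquot_repr z).

(* Deconcatenation. *)
Definition deconc : tensor_alg -> tensor tensor_alg tensor_alg :=
  tensor_alg_lift (fun s =>
    \sum_(i < (size s).+1) tens (word (take i s)) (word (drop i s))).
End TensorAlgebra.

Section TensorAlgebraLift.
Variables (V W : zmodType) (f : seq V -> W).
Hypothesis W2 : forall w : W, w + w = 0.
Hypothesis fD : forall s v w t,
  f (s ++ (v + w) :: t) = f (s ++ v :: t) + f (s ++ w :: t).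

Let F := ext2 (fun m : {fmonom V} => f (fmonom_val m)).
Let FB : zmod_morphism F := ext2_zmod_morphism _ W2.


Lemma tensor_alg_lift_to_rquot g : tensor_alg_lift f (to_rquot _ g) = F g.
Proof.
pose Fa : {additive _ -> _} := HB.pack F (GRing.isZmodMorphism.Build _ _ F FB).
have Fm m : Fa (mkmalgU m 1) = f (fmonom_val m) by exact: ext2U.
have MU (m m' : {fmonom V}) :
    mkmalgU m 1 * mkmalgU m' 1 = mkmalgU (mmul m m') 1 :> free_alg V.
  by rewrite malgM_def fgmulUU mulr1.
apply/eqP; rewrite -subr_eq0 -[F _ - _]FB; apply/eqP.
have : zspan (ideal_gens (@additive_rel V))
    (rquot_repr (to_rquot (@additive_rel V) g) - g).
  by apply/to_rquot_eq; rewrite rquot_reprK.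
elim=> [|_ [a [_ [b [[v [w ->]] ->]]]]|x y _ Ix _ Iy]; last 1 first.
- by rewrite FB Ix Iy subrr.
- exact: (raddf0 Fa).
rewrite -[LHS]/(Fa _); move: b; elim/malg2_ind: a => [|m a IHa] b.
  by rewrite !mul0r raddf0.
rewrite !mulrDl raddfD [X in _ + X]IHa addr0.
elim/malg2_ind: b => [|m' b IHb]; first by rewrite mulr0 raddf0.
rewrite mulrDr raddfD [X in _ + X]IHb addr0.
rewrite !(mulrBr, mulrBl) /letter !MU !raddfB.
rewrite [X in X - _ - _]Fm [X in _ - X - _]Fm [X in _ - X]Fm !fmM !fmU -!catA /= fD.
by rewrite addrAC addrK subrr.
Qed.

Lemma tensor_alg_lift_zmod_morphism : zmod_morphism (tensor_alg_lift f).
Proof.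
elim/to_rquot_ind=> x; elim/to_rquot_ind=> y.
by rewrite -raddfB !tensor_alg_lift_to_rquot FB.
Qed.

Lemma tensor_alg_lift_word s : tensor_alg_lift f (word s) = f s.
Proof.
have -> : word s = to_rquot _ (mkmalgU (FMonom s) 1).
  elim: s => [|v s IHs].
    rewrite /word big_nil -fmoneE; exact/esym/(rmorph1 (to_rquot (@additive_rel V))).
  rewrite /word big_cons -/(word s) IHs -rmorphM malgM_def fgmulUU mulr1.
  by congr (to_rquot _ (mkmalgU _ _)); apply/eqP; rewrite fmP fmM fmU.
by rewrite tensor_alg_lift_to_rquot /F ext2U.
Qed.
End TensorAlgebraLift.

Lemma malg2_add (X : choiceType) (g : {malg 'F_2[X]}) : g + g = 0.
Proof.
apply/malgP=> x; rewrite mcoeffD mcoeff0.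
by case: (mcoeff x g) => [[|[|?]] ?] //; apply: val_inj.
Qed.

Lemma tensor_add2 (U W : zmodType) (z : tensor U W) : z + z = 0.
Proof. by rewrite -[z]quot_reprK -raddfD malg2_add raddf0. Qed.

Lemma rquot_add2 (X : choiceType) (S : free_alg X -> Prop) (z : ring_quot S) :
  z + z = 0.
Proof. by elim/to_rquot_ind: z => g; rewrite -raddfD [g + g]malg2_add raddf0. Qed.

Lemma tensor_alg_add2 (V : zmodType) (z : tensor_alg V) : z + z = 0.
Proof. exact: rquot_add2. Qed.

Section TensorTheory.
Variables U W : zmodType.

Lemma tensDl (u u' : U) (w : W) : tens (u + u') w = tens u w + tens u' w.
Proof.
apply/eqP; rewrite -subr_eq0 opprD addrA -!raddfB -(raddf0 (to_quot _)).
by apply/eqP/to_quot_eq; rewrite subr0; apply: zspan_gen; left; exists u, u', w.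
Qed.

Lemma tensDr (u : U) (w w' : W) : tens u (w + w') = tens u w + tens u w'.
Proof.
apply/eqP; rewrite -subr_eq0 opprD addrA -!raddfB -(raddf0 (to_quot _)).
by apply/eqP/to_quot_eq; rewrite subr0; apply: zspan_gen; right; exists u, w, w'.
Qed.
End TensorTheory.

Section TensorAlgebraTheory.
Variable V : zmodType.

Lemma tgenD (v w : V) : tgen (v + w) = tgen v + tgen w.
Proof.
apply/eqP; rewrite -subr_eq0 opprD addrA -!raddfB -(raddf0 (to_rquot _)).
apply/eqP/to_rquot_eq; rewrite subr0; apply: zspan_gen.
exists 1, (letter (v + w) - letter v - letter w), 1.
by rewrite mul1r mulr1; split=> //; exists v, w.
Qed.

Lemma word_cat (s t : seq V) : word (s ++ t) = word s * word t.
Proof. exact: big_cat. Qed.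

Lemma word_cons v (s : seq V) : word (v :: s) = tgen v * word s.
Proof. exact: big_cons. Qed.

Lemma wordD s v w (t : seq V) :
  word (s ++ (v + w) :: t) = word (s ++ v :: t) + word (s ++ w :: t).
Proof. by rewrite !word_cat !word_cons tgenD mulrDl mulrDr. Qed.

Let split_word (s : seq V) :=
  \sum_(i < (size s).+1) tens (word (take i s)) (word (drop i s)).

Let split_wordD s v w t :
  split_word (s ++ (v + w) :: t) = split_word (s ++ v :: t) + split_word (s ++ w :: t).
Proof.
rewrite /split_word !size_cat /= -big_split /=; apply: eq_bigr => i _.
rewrite !take_cat !drop_cat; case: ltnP => [_|le_si]; first by rewrite wordD tensDr.
case: (i - size s)%N => [|j] /=; first by rewrite -[_ :: t]cat0s wordD tensDr.
by rewrite wordD tensDl.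
Qed.

Lemma deconc_zmod_morphism : zmod_morphism (@deconc V).
Proof. exact: tensor_alg_lift_zmod_morphism (@tensor_add2 _ _) split_wordD. Qed.

Lemma deconc_word (s : seq V) : deconc (word s) =
  \sum_(i < (size s).+1) tens (word (take i s)) (word (drop i s)).
Proof. exact: tensor_alg_lift_word (@tensor_add2 _ _) split_wordD s. Qed.
End TensorAlgebraTheory.

(* Tor^A(F_2, F_2) of a ring A graded by gr with A_0 = F_2, computed by the
   reduced bar complex: the tensor coalgebra on the augmentation ideal. *)
Section Bar.
Variables (A : pzRingType) (gr : nat -> A -> Prop).

(* The two-sided ideal generated by A_n for n > 0, that is, the direct sum of
   the A_n for n > 0. *)
Definition aug : Type :=
  sub_span (ideal_gens (fun a : A => exists2 n, (0 < n)%N & gr n a)).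
HB.instance Definition _ := GRing.Zmodule.on aug.
Definition aug_val (a : aug) : A := val a.

Lemma aug_mul_subproof (a b : aug) : aug_val a * aug_val b
  \in span_pred (ideal_gens (fun a : A => exists2 n, (0 < n)%N & gr n a)).
Proof. by apply/span_predP/idealMl/span_predP/(valP b). Qed.

Definition aug_mul (a b : aug) : aug :=
  exist _ (aug_val a * aug_val b) (aug_mul_subproof a b).

Definition bar : pzRingType := tensor_alg aug.

(* [a_1|...|a_n] |-> sum_i [a_1|...|a_i a_(i+1)|...|a_n] *)
Fixpoint bar_d_word (s : seq aug) : bar :=
  if s is a :: s' then
    if s' is b :: t then word (aug_mul a b :: t) + tgen a * bar_d_word s' else 0
  else 0.

Definition bar_d : bar -> bar := tensor_alg_lift bar_d_word.

(* The differential of bar \otimes bar. *)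
Definition bar_d2 : tensor bar bar -> tensor bar bar :=
  tensor_lift (fun u v => tens (bar_d u) v + tens u (bar_d v)).

Definition bar_cycles := sub_span (fun z : bar => bar_d z = 0).
HB.instance Definition _ := GRing.Zmodule.on bar_cycles.
Definition cycle_val (z : bar_cycles) : bar := val z.

Definition Tor : zmodType :=
  quot_span (fun z : bar_cycles => exists w, cycle_val z = bar_d w).

Definition Tor_class (z : bar_cycles) : Tor := to_quot _ z.

(* A cycle representing a class. *)
Definition Tor_repr (x : Tor) : bar := cycle_val (quot_repr x).

Definition Tor_deg (n : nat) (x : Tor) : Prop :=
  exists z : bar_cycles, gen_deg (@tgen aug) n (cycle_val z) /\ x = Tor_class z.

(* The comultiplication of x in Tor is the sum of the p.1 \otimes p.2 for p in
   s. The comultiplication is induced by deconcatenation through the Kunneth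
   isomorphism H(bar) \otimes H(bar) = H(bar \otimes bar), so this is an
   equality in H(bar \otimes bar). *)
Definition Tor_comul (x : Tor) (s : seq (Tor * Tor)) : Prop :=
  exists w, deconc (Tor_repr x) =
    \sum_(p <- s) tens (Tor_repr p.1) (Tor_repr p.2) + bar_d2 w.

(* bar_d and bar_d2 are well defined, and the spans in the definition of Tor
   add nothing. *)

Lemma aug_mulDl a a' b : aug_mul (a + a') b = aug_mul a b + aug_mul a' b.
Proof. by apply: val_inj; rewrite raddfD /= /aug_val raddfD /= mulrDl. Qed.

Lemma aug_mulDr a b b' : aug_mul a (b + b') = aug_mul a b + aug_mul a b'.
Proof. by apply: val_inj; rewrite raddfD /= /aug_val raddfD /= mulrDr. Qed.

Lemma bar_d_word_cons2 a b t : bar_d_word (a :: b :: t) =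
  word (aug_mul a b :: t) + tgen a * bar_d_word (b :: t).
Proof. by []. Qed.

Lemma bar_d_wordD s a b t : bar_d_word (s ++ (a + b) :: t) =
  bar_d_word (s ++ a :: t) + bar_d_word (s ++ b :: t).
Proof.
elim: s => [|c [|e s] IHs].
- case: t => [|d t]; first by rewrite addr0.
  rewrite !cat0s !bar_d_word_cons2 aug_mulDl (wordD [::]) (tgenD a b) mulrDl.
  by rewrite addrACA.
- rewrite !cat_cons !cat0s !bar_d_word_cons2 [in LHS]IHs aug_mulDr.
  by rewrite (wordD [::]) mulrDr addrACA.
- rewrite !cat_cons !bar_d_word_cons2 -!cat_cons IHs mulrDr.
  by rewrite (wordD (aug_mul c e :: s)) addrACA.
Qed.

Lemma bar_d_zmod_morphism : zmod_morphism bar_d.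
Proof. exact: tensor_alg_lift_zmod_morphism (@tensor_alg_add2 _) bar_d_wordD. Qed.

Lemma bar_dE s : bar_d (word s) = bar_d_word s.
Proof. exact: tensor_alg_lift_word (@tensor_alg_add2 _) bar_d_wordD s. Qed.

HB.instance Definition _ := GRing.isZmodMorphism.Build bar bar bar_d
  bar_d_zmod_morphism.

Let bar_d2_Dl u u' v : tens (bar_d (u + u')) v + tens (u + u') (bar_d v) =
  tens (bar_d u) v + tens u (bar_d v) + (tens (bar_d u') v + tens u' (bar_d v)).
Proof.
have -> : bar_d (u + u') = bar_d u + bar_d u' by exact: (raddfD bar_d).
by rewrite (tensDl (bar_d u)) (tensDl u) addrACA.
Qed.

Let bar_d2_Dr u v v' : tens (bar_d u) (v + v') + tens u (bar_d (v + v')) =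
  tens (bar_d u) v + tens u (bar_d v) + (tens (bar_d u) v' + tens u (bar_d v')).
Proof.
have -> : bar_d (v + v') = bar_d v + bar_d v' by exact: (raddfD bar_d).
by rewrite (tensDr u (bar_d v)) (tensDr _ v) addrACA.
Qed.

Lemma bar_d2_zmod_morphism : zmod_morphism bar_d2.
Proof.
exact: tensor_lift_zmod_morphism (@tensor_add2 _ _) bar_d2_Dl bar_d2_Dr.
Qed.

Lemma bar_d2E u v : bar_d2 (tens u v) = tens (bar_d u) v + tens u (bar_d v).
Proof.
exact: (tensor_lift_tens (@tensor_add2 _ _) bar_d2_Dl bar_d2_Dr).
Qed.

Lemma bar_cycleP (z : bar_cycles) : bar_d (cycle_val z) = 0.
Proof.
have /span_predP := valP z; rewrite -/(cycle_val z).
elim=> [|x //|x y _ dx _ dy]; first exact: raddf0.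
by rewrite raddfB /= dx dy subrr.
Qed.

Lemma Tor_class_eq0 (z : bar_cycles) :
  Tor_class z = 0 <-> exists w, cycle_val z = bar_d w.
Proof.
rewrite -(raddf0 (to_quot _)) /Tor_class to_quot_eq subr0; split=> [|[w zw]].
  elim=> [|x //|x y _ [u xu] _ [v yv]]; first by exists 0; rewrite raddf0.
  by exists (u - v); rewrite raddfB /= -xu -yv.
by apply: zspan_gen; exists w.
Qed.
End Bar.

Section Koszul.
Variables (V : zmodType) (R : tensor_alg V -> Prop).

(* R is a subspace of the tensor square of V. *)
Definition quadratic_relations : Prop :=
  [/\ forall r, R r -> gen_deg (@tgen V) 2 r, R 0 &
      forall r r', R r -> R r' -> R (r - r')].

Definition quadratic_alg : pzRingType := ring_quot R.

Definition qgen (v : V) : quadratic_alg := to_rquot R (tgen v).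

Definition koszul_dual_deg (n : nat) (z : tensor_alg V) : Prop :=
  gen_deg (@tgen V) n z /\
  forall i j, (i + j + 2)%N = n ->
    zspan (fun y => exists a r b, [/\ gen_deg (@tgen V) i a, R r,
      gen_deg (@tgen V) j b & y = a * r * b]) z.

Definition koszul_dual := sub_span (fun z => exists n, koszul_dual_deg n z).
HB.instance Definition _ := GRing.Zmodule.on koszul_dual.
Definition kd_val (c : koszul_dual) : tensor_alg V := val c.

(* The comultiplication of c is the sum of the p.1 \otimes p.2 for p in s. *)
Definition koszul_dual_comul (c : koszul_dual)
    (s : seq (koszul_dual * koszul_dual)) : Prop :=
  deconc (kd_val c) = \sum_(p <- s) tens (kd_val p.1) (kd_val p.2).
End Koszul.

(* Isomorphisms of graded coalgebras between the Koszul dual coalgebra of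
   T(V)/(R) and Tor^A(F_2, F_2). Both are F_2 in degree 0, so that f preserves
   the counits. *)
Definition is_coalgebra_iso (V : zmodType) (R : tensor_alg V -> Prop)
    (A : pzRingType) (gr : nat -> A -> Prop)
    (f : {additive koszul_dual R -> Tor gr}) : Prop :=
  [/\ bijective f,
      forall n (c : koszul_dual R), koszul_dual_deg R n (kd_val c) -> Tor_deg n (f c) &
      forall c, exists2 s, koszul_dual_comul c s &
        Tor_comul (f c) [seq (f p.1, f p.2) | p <- s]].

Definition koszul (A : pzRingType) (gr : nat -> A -> Prop) : Prop :=
  exists (V : lmodType 'F_2) (R : tensor_alg V -> Prop),
    [/\ quadratic_relations R,
        exists2 phi : {rmorphism quadratic_alg R -> A}, bijective phi &
          forall n x, gen_deg (@qgen V R) n x <-> gr n (phi x) &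
        exists f : {additive koszul_dual R -> Tor gr}, is_coalgebra_iso f].

Section Milnor.

Definition nonzero (F : fieldType) := {a : F | a != 0}.

Variable F : fieldType.

Definition milnor_rel (z : free_alg (nonzero F)) : Prop :=
  (exists a b c : nonzero F, val c = val a * val b /\
     z = letter c - letter a - letter b) \/
  (exists a b : nonzero F, val a + val b = 1 /\ z = letter a * letter b).

Definition milnorK : pzRingType := ring_quot milnor_rel.

Definition sym (a : nonzero F) : milnorK := to_rquot milnor_rel (letter a).

Definition pure_symbol (s : seq (nonzero F)) : milnorK := \prod_(a <- s) sym a.

Lemma symM (a b c : nonzero F) :
  val c = val a * val b -> sym c = sym a + sym b.
Proof.
move=> cab; apply/eqP; rewrite -subr_eq0 opprD addrA -!raddfB.
rewrite -(raddf0 (to_rquot (@milnor_rel))); apply/eqP/to_rquot_eq; rewrite subr0.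
apply: zspan_gen; exists 1, (letter c - letter a - letter b), 1.
by rewrite mul1r mulr1; split=> //; left; exists a, b, c.
Qed.

Lemma sym_steinberg (a b : nonzero F) : val a + val b = 1 -> sym a * sym b = 0.
Proof.
move=> ab1; rewrite -rmorphM -(raddf0 (to_rquot (@milnor_rel))).
apply/to_rquot_eq; rewrite subr0; apply: zspan_gen.
exists 1, (letter a * letter b), 1.
by rewrite mul1r mulr1; split=> //; right; exists a, b.
Qed.

Lemma milnorK_add2 (z : milnorK) : z + z = 0.
Proof. exact: rquot_add2. Qed.

Lemma sym_opp (a b : nonzero F) : val b = - val a -> sym a * sym b = 0.
Proof.
case: a b => [a a0] [b b0] /= ba; set sa := exist _ a a0; set sb := exist _ b b0.
have [a1|a1] := eqVneq a 1.
  have /symM : val sa = val sa * val sa by rewrite /= a1 mulr1.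
  by rewrite milnorK_add2 => ->; rewrite mul0r.
have c0 : 1 - a != 0 by rewrite subr_eq0 eq_sym.
have d0 : 1 - a^-1 != 0 by rewrite subr_eq0 eq_sym invr_eq1.
have i0 : a^-1 != 0 by rewrite invr_eq0.
pose sc : nonzero F := exist _ (1 - a) c0.
pose sd : nonzero F := exist _ (1 - a^-1) d0.
pose si : nonzero F := exist _ a^-1 i0.
have e1 : sym sc = sym sb + sym sd.
  by apply: symM; rewrite /= ba mulrBr mulr1 mulNr mulfV // opprK addrC.
have u0 : (1 : F) != 0 by exact: oner_neq0.
pose su : nonzero F := exist _ 1 u0.
have su0 : sym su = 0.
  have /symM : val su = val su * val su by rewrite /= mulr1.
  by rewrite milnorK_add2.
have e2 : sym su = sym sa + sym si by apply: symM; rewrite /= mulfV.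
have e3 : sym sa * sym sc = 0 by apply: sym_steinberg; rewrite /= addrC subrK.
have e4 : sym si * sym sd = 0 by apply: sym_steinberg; rewrite /= addrC subrK.
have e5 : sym sa * sym sd = 0.
  have : (sym sa + sym si) * sym sd = 0 by rewrite -e2 su0 mul0r.
  by rewrite mulrDl e4 addr0.
by rewrite e1 mulrDr e5 addr0 in e3.
Qed.

Lemma symC (a b : nonzero F) : sym a * sym b = sym b * sym a.
Proof.
have ab0 : val a * val b != 0 by rewrite mulf_neq0 ?(valP a) ?(valP b).
have na0 : - val a != 0 by rewrite oppr_eq0 (valP a).
have nb0 : - val b != 0 by rewrite oppr_eq0 (valP b).
have nab0 : - (val a * val b) != 0 by rewrite oppr_eq0.
pose ab : nonzero F := exist _ (val a * val b) ab0.
pose na : nonzero F := exist _ (- val a) na0.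
pose nb : nonzero F := exist _ (- val b) nb0.
pose nab : nonzero F := exist _ (- (val a * val b)) nab0.
have e0 : sym ab * sym nab = 0 by exact: sym_opp.
have e1 : sym ab = sym a + sym b by exact: symM.
have e2 : sym nab = sym na + sym b by apply: symM; rewrite /= mulNr.
have e3 : sym nab = sym nb + sym a by apply: symM; rewrite /= mulNr mulrC.
have e4 : sym a * sym na = 0 by exact: sym_opp.
have e5 : sym b * sym nb = 0 by exact: sym_opp.
move: e0; rewrite e1 mulrDl {1}e2 e3 !mulrDr e4 e5 !add0r => e.
by rewrite -[LHS]addr0 -(milnorK_add2 (sym b * sym a)) addrA e add0r.
Qed.

Lemma milnorK_ind (P : milnorK -> Prop) :
  P 0 -> (forall s z, P z -> P (pure_symbol s + z)) -> forall z, P z.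
Proof.
move=> P0 PD z; elim/to_rquot_ind: z => g.
elim/malg2_ind: g => [|m g IHg]; first by rewrite raddf0.
rewrite raddfD; suff E : to_rquot (@milnor_rel) (mkmalgU m 1) = pure_symbol m.
  by rewrite [X in P (X + _)]E; apply: PD.
case: m => s /=; rewrite /pure_symbol -rmorph_prod; congr (to_rquot _ _).
elim: s => [|a s IHs]; first by rewrite big_nil -fmoneE.
rewrite big_cons -IHs malgM_def fgmulUU mulr1.
by congr (mkmalgU _ _); apply/eqP; rewrite fmP fmM fmU.
Qed.

Lemma milnorKC (x y : milnorK) : x * y = y * x.
Proof.
have symPC a s : sym a * pure_symbol s = pure_symbol s * sym a.
  elim: s => [|b s IHs]; first by rewrite /pure_symbol big_nil mulr1 mul1r.
  by rewrite /pure_symbol big_cons mulrA symC -!mulrA IHs.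
have PC s t : pure_symbol s * pure_symbol t = pure_symbol t * pure_symbol s.
  elim: s => [|a s IHs]; first by rewrite /pure_symbol big_nil mulr1 mul1r.
  by rewrite /pure_symbol big_cons -mulrA IHs mulrA symPC mulrA.
elim/milnorK_ind: x => [|s x IHx]; first by rewrite mul0r mulr0.
rewrite mulrDl mulrDr IHx; congr (_ + _).
elim/milnorK_ind: y {IHx} => [|t y IHy]; first by rewrite mul0r mulr0.
by rewrite mulrDl mulrDr IHy PC.
Qed.

Lemma milnorK1_neq0 : (1 : milnorK) <> 0.
Proof.
rewrite -(rmorph1 (to_rquot (@milnor_rel))) -(raddf0 (to_rquot (@milnor_rel))).
move/to_rquot_eq; rewrite subr0 => I1.
pose c0 : {rmorphism free_alg (nonzero F) -> 'F_2} :=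
  @mcoeff {fmonom (nonzero F)} 'F_2 (fmone _).
have h : forall z, ideal (@milnor_rel) z -> c0 z = 0.
  have l0 a : c0 (letter a) = 0.
    rewrite /c0 /= /letter mcoeffU; case: eqP => // /(congr1 (@fmonom_val _)).
    by rewrite fmU fm1.
  move=> z; elim=> [|_ [a [r [b [Rr ->]]]]|x y _ Ix _ Iy]; first exact: raddf0.
    rewrite !rmorphM; case: Rr => [[c [d [e [_ ->]]]]|[c [d [_ ->]]]].
      by rewrite !rmorphB !l0 !subr0 mulr0 mul0r.
    by rewrite rmorphM !l0 !mulr0 mul0r.
  by rewrite rmorphB Ix Iy subrr.
by have := h _ I1; rewrite rmorph1 => /eqP; rewrite oner_eq0.
Qed.
End Milnor.

Section IsotropicMilnor.
Variables (k F : fieldType) (iota : {rmorphism k -> F}).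

Lemma base_change_subproof (a : nonzero k) : iota (val a) != 0.
Proof. by rewrite fmorph_eq0 (valP a). Qed.
Definition base_change (a : nonzero k) : nonzero F :=
  exist _ (iota (val a)) (base_change_subproof a).

Definition killed (x : milnorK F) : Prop :=
  exists s : seq (nonzero k), pure_symbol s <> 0 /\
    x * pure_symbol (map base_change s) = 0.

(* Since killed is closed under multiplication, the ideal that it generates is
   killed itself as soon as killed is closed under addition. *)
Lemma ideal_killed :
  (forall x y, killed x -> killed y -> killed (x + y)) ->
  forall x, ideal killed x <-> killed x.
Proof.
move=> killedD x; split=> [|kx]; last first.
  by apply: zspan_gen; exists 1, x, 1; rewrite mul1r mulr1.
elim=> [|_ [a [y [b [[s [s0 ys]] ->]]]]|y z _ ky _ kz].
- by exists [::]; split; [rewrite /pure_symbol big_nil; exact: milnorK1_neq0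
                        | exact: mul0r].
- by exists s; split=> //; rewrite -!mulrA (milnorKC b) (mulrA y) ys mul0r mulr0.
have -> : - z = z by apply/eqP; rewrite eq_sym -addr_eq0 milnorK_add2.
exact: killedD.
Qed.

(* The quotient by the ideal generated by the union of the annihilators. When
   that union is an ideal, it is this ideal by ideal_killed. *)
Definition iso_milnorK : pzRingType := ring_quot killed.

Definition iso_sym (a : nonzero F) : iso_milnorK := to_rquot killed (sym a).
End IsotropicMilnor.

Definition flexible (k : fieldType) : Prop :=
  exists (k0 : fieldType) (iota : {rmorphism k0 -> k}) (t : nat -> k),
    (forall n (p : mpoly n k0),
       (map_mpoly iota p).@[fun i : 'I_n => t i] = 0 -> p = 0) /\
    (forall y : k, exists n (p q : mpoly n k0),
       (map_mpoly iota q).@[fun i : 'I_n => t i] != 0 /\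
       y = (map_mpoly iota p).@[fun i : 'I_n => t i] /
           (map_mpoly iota q).@[fun i : 'I_n => t i]).

Definition is_rational_function_field (k F : fieldType)
    (iota : {rmorphism k -> F}) (x : F) : Prop :=
  (forall p : {poly k}, (map_poly iota p).[x] = 0 -> p = 0) /\
  (forall y : F, exists p q : {poly k}, (map_poly iota q).[x] != 0 /\
     y = (map_poly iota p).[x] / (map_poly iota q).[x]).

(* Main.v *)
Require Import Defs.
From HB Require Import structures.
From mathcomp Require Import all_boot all_order all_algebra.
From mathcomp Require Import boolp fieldext ring zify.
From mathcomp Require Import multinomials.monalg multinomials.mpoly.

(* Let A be the isotropic Milnor ring of k(x)/k.  Since A is additively generated
   by products of symbols, it is enough to show {f}{g} = 0 in A for polynomials f
   and g, by induction on their degrees.  Let P have degree d >= 1 and let f be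
   prime to P with deg f <= 2d - 2.  The polynomials
     u^2 - f + P h = sum_i c_i p_i^2        (deg u < d, deg h < d - 1, i < 2d - 1),
   where the p_i^2 are a fixed basis of the polynomials of degree at most 2d - 2,
   depend on 2d - 1 parameters; taking these to be fresh variables of k, the
   symbol alpha = {c_0, ..., c_(2d-2)} is nonzero.  Now w = f - P h is a value of
   the Pfister form <<c_0, ..., c_(2d-2)>>, so alpha {w} = 0, and the Steinberg
   relation for w + P h = f yields alpha {f} ({P} + {h} + {f}) = 0.  Hence
   {f}{P} = {f}{h} in A, with deg h < d - 1, and {f} = 0 in A if f is constant.
   Two polynomials of the same degree are handled by f = a g + r.
   To see that alpha is nonzero, extend k so that f becomes a square g^2 modulo P,
   write g^2 - f + P h_0 = 0, and specialize the fresh variables to this solution: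
   the c_i are local coordinates there, and symbols of independent variables are
   detected by residues.
   The ring A has an augmentation: the grading shows that an element of
   augmentation 1 kills no nonzero symbol.  So A = F_2 + A_1 with A_1^2 = 0; both
   its Koszul dual and its reduced bar complex are the tensor coalgebra of A_1,
   the latter with zero differential. *)

Set Implicit Arguments.
Unset Strict Implicit.
Unset Printing Implicit Defensive.

Import GRing.Theory.
Local Open Scope ring_scope.

(** * Ring morphisms out of the Milnor ring *)

Section Lifts.

Lemma malg_fmonomM (X : choiceType) (m m' : {fmonom X}) :
  mkmalgU m 1 * mkmalgU m' 1 = mkmalgU (mmul m m') 1 :> free_alg X.
Proof. by rewrite malgM_def fgmulUU mulr1. Qed.

Lemma free_alg_lift (X : choiceType) (B : pzRingType) (e : X -> B) :
  (forall b : B, b + b = 0) ->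
  exists phi : {rmorphism free_alg X -> B}, forall x, phi (letter x) = e x.
Proof.
move=> B2; pose f (m : {fmonom X}) := \prod_(x <- fmonom_val m) e x.
have fM m m' : f (mmul m m') = f m * f m' by rewrite /f fmM big_cat.
pose phi : free_alg X -> B := ext2 f.
have phiB : zmod_morphism phi by exact: ext2_zmod_morphism.
pose phiA : {additive free_alg X -> B} :=
  HB.pack phi (GRing.isZmodMorphism.Build _ _ phi phiB).
have phiU m : phiA (mkmalgU m 1) = f m by exact: ext2U.
have phiAD u v : phiA (u + v) = phiA u + phiA v by exact: raddfD.
have phiM : monoid_morphism phi.
  split; first by rewrite [LHS](phiU (fmone X)) /f fm1 big_nil.
  move=> a b; rewrite -[phi (a * b)]/(phiA (a * b)) -[phi a]/(phiA a) -[phi b]/(phiA b).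
  elim/malg2_ind: a => [|m a IHa]; first by rewrite mul0r raddf0 mul0r.
  transitivity (phiA (mkmalgU m 1 * b) + phiA (a * b)).
    by rewrite -phiAD; congr (phiA _); exact: mulrDl.
  transitivity ((phiA (mkmalgU m 1) + phiA a) * phiA b); last first.
    by congr (_ * _); exact/esym/phiAD.
  rewrite [RHS]mulrDl; congr (_ + _); last exact: IHa.
  elim/malg2_ind: b {IHa} => [|m' b IHb]; first by rewrite mulr0 raddf0 mulr0.
  transitivity (phiA (mkmalgU m 1 * mkmalgU m' 1) + phiA (mkmalgU m 1 * b)).
    by rewrite -phiAD; congr (phiA _); exact: mulrDr.
  transitivity (phiA (mkmalgU m 1) * (phiA (mkmalgU m' 1) + phiA b)); last first.
    by congr (_ * _); exact/esym/phiAD.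
  rewrite [RHS]mulrDr; congr (_ + _); last exact: IHb.
  by rewrite malg_fmonomM [LHS]phiU fM !phiU.
pose phiR : {rmorphism free_alg X -> B} :=
  HB.pack phi (GRing.isZmodMorphism.Build _ _ phi phiB)
    (GRing.isMonoidMorphism.Build _ _ phi phiM).
exists phiR => x.
by rewrite [LHS]phiU /f fmU big_seq1.
Qed.

Lemma rquot_lift (A B : pzRingType) (S : A -> Prop) (phi : {rmorphism A -> B}) :
  (forall s, S s -> phi s = 0) ->
  exists psi : {rmorphism ring_quot S -> B}, forall a, psi (to_rquot S a) = phi a.
Proof.
move=> phiS; pose psi (z : ring_quot S) := phi (rquot_repr z).
have psiE a : psi (to_rquot S a) = phi a.
  apply/eqP; rewrite -subr_eq0 -rmorphB; apply/eqP.
  have : ideal S (rquot_repr (to_rquot S a) - a).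
    by apply/to_rquot_eq; rewrite rquot_reprK.
  elim=> [|_ [b [s [c [/phiS s0 ->]]]]|x y _ Ix _ Iy]; first exact: raddf0.
    by rewrite !rmorphM s0 mulr0 mul0r.
  by rewrite rmorphB Ix Iy subrr.
have psiB : zmod_morphism psi.
  elim/to_rquot_ind=> x; elim/to_rquot_ind=> y.
  by rewrite -raddfB !psiE raddfB.
have psiM : monoid_morphism psi.
  split; first by rewrite -(rmorph1 (to_rquot S)) psiE rmorph1.
  elim/to_rquot_ind=> x; elim/to_rquot_ind=> y.
  by rewrite -rmorphM !psiE rmorphM.
pose psiR : {rmorphism ring_quot S -> B} :=
  HB.pack psi (GRing.isZmodMorphism.Build _ _ psi psiB)
    (GRing.isMonoidMorphism.Build _ _ psi psiM).
by exists psiR.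
Qed.

Lemma tensor_alg_ring_lift (V : zmodType) (B : pzRingType) (e : V -> B) :
  (forall b : B, b + b = 0) -> {morph e : v w / v + w} ->
  exists phi : {rmorphism tensor_alg V -> B}, forall v, phi (tgen v) = e v.
Proof.
move=> B2 eD; have [phi phiE] := free_alg_lift e B2.
have [|psi psiE] := @rquot_lift _ _ (@additive_rel V) phi.
  by move=> _ [v [w ->]]; rewrite !rmorphB !phiE eD addrAC addrK subrr.
by exists psi => v; rewrite psiE.
Qed.

Lemma milnorK_lift (F : fieldType) (B : pzRingType) (e : nonzero F -> B) :
  (forall b : B, b + b = 0) ->
  (forall a b c, val c = val a * val b -> e c = e a + e b) ->
  (forall a b, val a + val b = 1 -> e a * e b = 0) ->
  exists phi : {rmorphism milnorK F -> B}, forall a, phi (sym a) = e a.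
Proof.
move=> B2 eM eS; have [phi phiE] := free_alg_lift e B2.
have [|psi psiE] := @rquot_lift _ _ (@milnor_rel F) phi.
  move=> _ [[a [b [c [/eM abc ->]]]]|[a [b [/eS ab ->]]]].
    by rewrite !rmorphB !phiE abc addrAC addrK subrr.
  by rewrite rmorphM !phiE.
by exists psi => v; rewrite psiE.
Qed.

End Lifts.

(** * Relations between symbols and values of Pfister forms *)

Section Symbols.
Variable F : fieldType.
Implicit Types a b c : nonzero F.

Lemma sym_eq1 a : val a = 1 -> sym a = 0.
Proof.
move=> a1; have /symM : val a = val a * val a by rewrite a1 mulr1.
by rewrite milnorK_add2.
Qed.

Lemma symMsq a b d : d != 0 -> val b = val a * d ^+ 2 -> sym b = sym a.
Proof.
move=> d0 bE; pose sd : nonzero F := exist _ d d0.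
have d20 : d ^+ 2 != 0 by rewrite expf_neq0.
pose sd2 : nonzero F := exist _ (d ^+ 2) d20.
rewrite (@symM _ a sd2) // (@symM _ sd sd sd2) ?milnorK_add2 ?addr0 //.
Qed.

Lemma sym_sq a d : val a = d ^+ 2 -> sym a = 0.
Proof.
move=> aE; have d0 : d != 0.
  by have := valP a; rewrite aE; apply: contraNneq => ->; rewrite expr0n.
pose s1 : nonzero F := exist _ 1 (oner_neq0 F).
by rewrite (@symMsq s1 a d) // ?mul1r // sym_eq1.
Qed.

Lemma pure_symbol_cons a s : pure_symbol (a :: s) = sym a * pure_symbol s.
Proof. by rewrite /pure_symbol big_cons. Qed.

Lemma pure_symbol_nil : pure_symbol [::] = 1 :> milnorK F.
Proof. by rewrite /pure_symbol big_nil. Qed.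

(** This is the Steinberg relation for a/c + b/c = 1; modulo 2, {a/c} is {a} + {c}. *)
Lemma sym_steinbergD a b c : val a + val b = val c ->
  (sym a + sym c) * (sym b + sym c) = 0.
Proof.
move=> abc; have c0 := valP c.
have a0 : val a / val c != 0 by rewrite mulf_neq0 ?invr_eq0 ?(valP a).
have b0 : val b / val c != 0 by rewrite mulf_neq0 ?invr_eq0 ?(valP b).
pose sa : nonzero F := exist _ (val a / val c) a0; pose sb : nonzero F := exist _ (val b / val c) b0.
have -> : sym a + sym c = sym sa.
  rewrite (@symM _ sa c a) /= ?divfK //.
  by rewrite -addrA milnorK_add2 addr0.
have -> : sym b + sym c = sym sb.
  rewrite (@symM _ sb c b) /= ?divfK //.
  by rewrite -addrA milnorK_add2 addr0.
by apply: sym_steinberg; rewrite /= -mulrDl abc mulfV.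
Qed.

(** Multiplying the first relation by z removes the terms in t. It is applied with z the tail of a
    symbol and t the symbol of a value that annihilates it. *)
Lemma absorb_mul (R : pzRingType) (x y t z : R) :
  (x + t) * (y + t) = 0 -> t * z = 0 -> x * y = y * x -> t * y = y * t ->
  y * (x * z) = 0.
Proof.
move=> /(congr1 ( *%R^~ z)); rewrite mul0r -mulrA mulrDl [(y + t) * z]mulrDl.
move=> + tz xy ty; rewrite tz addr0 !mulrA xy ty -!mulrA tz mulr0 addr0.
by [].
Qed.

(* Such a w is a value of the Pfister form <<c_1, ..., c_n>>. *)
Lemma sym_pfister_value (s : seq (nonzero F * F)) (u : F) (w : nonzero F) :
  val w = u ^+ 2 - \sum_(cp <- s) val cp.1 * cp.2 ^+ 2 ->
  sym w * pure_symbol [seq cp.1 | cp <- s] = 0.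
Proof.
elim: s w => [|[c p] s IHs] w; first by rewrite big_nil subr0 => /sym_sq ->; rewrite mul0r.
rewrite big_cons /= pure_symbol_cons opprD addrCA.
set w' := _ - _ => wE.
have [p0|p0] := eqVneq p 0.
  rewrite mulrA symC -mulrA IHs ?mulr0 //.
  by apply: etrans wE _; rewrite p0 expr0n /= mulr0 oppr0 add0r.
(* Here w' = 0 gives w = - c p^2, and {c}{-c} = 0. *)
have [w'0|w'0] := eqVneq w' 0.
  have Nc0 : - val c != 0 by rewrite oppr_eq0 (valP c).
  pose sNc : nonzero F := exist _ (- val c) Nc0.
  have -> : sym w = sym sNc by apply: (symMsq p0); apply: etrans wE _; rewrite w'0 addr0 /= mulNr.
  by rewrite mulrA symC (@sym_opp _ c sNc) // mul0r.
pose sw' : nonzero F := exist _ w' w'0.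
have IH : sym sw' * pure_symbol [seq cp.1 | cp <- s] = 0 by exact: IHs.
have cp0 : val c * p ^+ 2 != 0 by rewrite mulf_neq0 ?expf_neq0 ?(valP c).
pose scp : nonzero F := exist _ (val c * p ^+ 2) cp0.
have scpE : sym scp = sym c by exact: (symMsq p0).
(* The Steinberg relation for c p^2 + w = w' is multiplied by the tail, which {w'} annihilates by
   induction. *)
apply: (absorb_mul _ IH); rewrite 1?symC //.
rewrite -scpE; apply: sym_steinbergD.
by apply: etrans (congr1 (+%R _) wE) _; rewrite /= addrA subrr add0r.
Qed.
End Symbols.

(** * Residue and specialization at x = 0 *)

Section PolyOrder.
Variable k : fieldType.
Implicit Types p q r : {poly k}.

Lemma poly_orderP p : p != 0 -> exists n p', p = 'X^n * p' /\ p'`_0 != 0.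
Proof.
move=> p0; have [n [q /implyP/(_ p0) q0 ->]] := multiplicity_XsubC p 0.
by exists n, q; rewrite polyC0 subr0 mulrC -horner_coef0.
Qed.

Lemma coef_XnM_lt n p i : (i < n)%N -> ('X^n * p)`_i = 0.
Proof. by move=> lt_in; rewrite coefXnM lt_in. Qed.

Lemma coef_XnM_eq n p : ('X^n * p)`_n = p`_0.
Proof. by rewrite coefXnM ltnn subnn. Qed.

(** Compare the orders n and l: the smaller one is the order of the sum, and when they agree the
    lowest coefficients either add up to a nonzero one or cancel. *)
Lemma poly_order_add n l m p q r :
  p`_0 != 0 -> q`_0 != 0 -> r`_0 != 0 -> 'X^n * p + 'X^l * q = 'X^m * r ->
  [\/ [/\ n = m, l = m & p`_0 + q`_0 = r`_0], [/\ (m < n)%N, l = m & q`_0 = r`_0],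
      [/\ n = m, (m < l)%N & p`_0 = r`_0] | [/\ n = l, (l < m)%N & p`_0 = - q`_0]].
Proof.
move=> p0 q0 r0 E; have C i : ('X^n * p)`_i + ('X^l * q)`_i = ('X^m * r)`_i.
  by rewrite -coefD E.
have := C n; have := C l; have := C m; rewrite !coef_XnM_eq.
have [nl|ln|->] := ltngtP n l.
- rewrite (coef_XnM_lt q nl); have [nm|mn|nm] := ltngtP n m.
  + by rewrite (coef_XnM_lt r nm) addr0 => _ _ p00; rewrite p00 eqxx in p0.
  + rewrite (coef_XnM_lt p mn) (coef_XnM_lt q (ltn_trans mn nl)) addr0.
    by move=> r00; rewrite -r00 eqxx in r0.
  + by subst m; rewrite !coef_XnM_eq addr0 => _ _ pr; constructor 3; split.
- rewrite (coef_XnM_lt p ln) add0r; have [lm|ml|lm] := ltngtP l m.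
  + by rewrite (coef_XnM_lt r lm) => _ q00; rewrite q00 eqxx in q0.
  + rewrite (coef_XnM_lt q ml) (coef_XnM_lt p (ltn_trans ml ln)) addr0.
    by move=> r00; rewrite -r00 eqxx in r0.
  + by subst m; rewrite !coef_XnM_eq => _ qr; constructor 2; split.
- rewrite !coef_XnM_eq; have [lm|ml|->] := ltngtP l m.
  + rewrite (coef_XnM_lt r lm) => _ /eqP; rewrite addr_eq0 => /eqP pq.
    by constructor 4; split.
  + rewrite (coef_XnM_lt q ml) (coef_XnM_lt p ml) addr0.
    by move=> r00; rewrite -r00 eqxx in r0.
  + by rewrite !coef_XnM_eq => pqr; constructor 1; split.
Qed.

Lemma poly_order_inj n m p q : p`_0 != 0 -> q`_0 != 0 ->
  'X^n * p = 'X^m * q -> n = m /\ p`_0 = q`_0.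
Proof.
move=> p0 q0 E; have C i : ('X^n * p)`_i = ('X^m * q)`_i by rewrite E.
have := C n; have := C m; rewrite !coef_XnM_eq; have [nm|mn|->] := ltngtP n m.
- by rewrite (coef_XnM_lt q nm) => _ p00; rewrite p00 eqxx in p0.
- by rewrite (coef_XnM_lt p mn) => q00; rewrite -q00 eqxx in q0.
- by rewrite coef_XnM_eq; split.
Qed.
End PolyOrder.

Section Tame.
Variables (k F : fieldType) (iota : {rmorphism k -> F}) (x : F).
Hypothesis ratF : is_rational_function_field iota x.

Definition evalx (p : {poly k}) : F := (map_poly iota p).[x].

Lemma evalxD p q : evalx (p + q) = evalx p + evalx q.
Proof. by rewrite /evalx rmorphD hornerD. Qed.
Lemma evalxB p q : evalx (p - q) = evalx p - evalx q.
Proof. by rewrite /evalx rmorphB hornerD hornerN. Qed.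
Lemma evalxM p q : evalx (p * q) = evalx p * evalx q.
Proof. by rewrite /evalx rmorphM hornerM. Qed.
Lemma evalxC c : evalx c%:P = iota c.
Proof. by rewrite /evalx map_polyC hornerC. Qed.
Lemma evalxX : evalx 'X = x.
Proof. by rewrite /evalx map_polyX hornerX. Qed.

Lemma evalx_eq0 p : (evalx p == 0) = (p == 0).
Proof.
apply/eqP/eqP => [|->]; first exact: (ratF.1).
by rewrite /evalx rmorph0 horner0.
Qed.

Lemma evalx_inj : injective evalx.
Proof.
by move=> p q /eqP; rewrite -subr_eq0 -evalxB evalx_eq0 subr_eq0 => /eqP.
Qed.

(* a = x^n u with u a unit at x = 0 of value r, and b the parity of n. *)
Definition leading (a : F) (b : bool) (r : k) : Prop :=
  exists n m (p q : {poly k}), [/\ p`_0 != 0, q`_0 != 0, a * evalx ('X^m * q) = evalx ('X^n * p),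
    r = p`_0 / q`_0 & b = odd (n + m)].

Lemma leading_neq0 a b r : leading a b r -> r != 0.
Proof.
by move=> [n [m [p [q [p0 q0 _ -> _]]]]]; rewrite mulf_neq0 ?invr_eq0.
Qed.

Lemma leading_exists a : a != 0 -> exists b r, leading a b r.
Proof.
move=> a0; have [p [q [q0 aE]]] := ratF.2 a; rewrite -/(evalx p) -/(evalx q) in q0 aE.
have p0 : evalx p != 0 by apply: contraNneq a0 => p0; rewrite aE p0 mul0r.
move: (p0) (q0); rewrite !evalx_eq0 => /poly_orderP [n [p' [pE p'0]]].
move=> /poly_orderP [m [q' [qE q'0]]].
exists (odd (n + m)), (p'`_0 / q'`_0), n, m, p', q'.
by rewrite -pE -qE aE divfK.
Qed.

Lemma leading_inj a b r b' r' : leading a b r -> leading a b' r' -> b = b' /\ r = r'.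
Proof.
move=> [n [m [p [q [p0 q0 E -> ->]]]]] [n' [m' [p' [q' [p'0 q'0 E' -> ->]]]]].
have : 'X^(n + m') * (p * q') = 'X^(n' + m) * (p' * q).
  apply: evalx_inj; rewrite !exprD.
  have -> : 'X^n * 'X^m' * (p * q') = 'X^n * p * ('X^m' * q') by ring.
  have -> : 'X^n' * 'X^m * (p' * q) = 'X^n' * p' * ('X^m * q) by ring.
  by rewrite !(evalxM (_ * _) (_ * _)) -E -E'; ring.
case/poly_order_inj; rewrite ?coef0M ?mulf_neq0 // => nm pq.
split; last by apply/eqP; rewrite eqr_div // pq.
by have := congr1 odd nm; rewrite !oddD; do 4 case: (odd _).
Qed.

Lemma leadingM a b r a' b' r' : leading a b r -> leading a' b' r' ->
  leading (a * a') (b (+) b') (r * r').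
Proof.
move=> [n [m [p [q [p0 q0 E -> ->]]]]] [n' [m' [p' [q' [p'0 q'0 E' -> ->]]]]].
exists (n + n')%N, (m + m')%N, (p * p'), (q * q').
rewrite !coef0M !mulf_neq0 //; split=> //.
- rewrite !exprD.
  have -> : 'X^n * 'X^n' * (p * p') = 'X^n * p * ('X^n' * p') by ring.
  have -> : 'X^m * 'X^m' * (q * q') = 'X^m * q * ('X^m' * q') by ring.
  by rewrite !(evalxM (_ * _) (_ * _)) -E -E'; ring.
- by rewrite mulf_div.
- by rewrite !oddD; do 4 case: (odd _).
Qed.

Lemma leading_unit (p : {poly k}) : p`_0 != 0 -> leading (evalx p) false p`_0.
Proof.
move=> p0; exists 0, 0, p, 1; rewrite coef1 oner_neq0 !mul1r divr1; split=> //.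
by rewrite [evalx 1]evalxC rmorph1 mulr1.
Qed.

Lemma leading_const c : c != 0 -> leading (iota c) false c.
Proof. by move=> c0; have := @leading_unit c%:P; rewrite coefC evalxC; apply. Qed.

Lemma leading_x : leading x true 1.
Proof.
exists 1, 0, 1, 1; rewrite coef1 oner_neq0 !mulr1 divr1; split=> //.
by rewrite expr1 evalxX [evalx 1]evalxC rmorph1 mulr1.
Qed.

(** The four cases are: two units at 0, a zero of a, a zero of b, and poles of the same order, whose
    leading coefficients cancel. *)
Lemma leading_steinberg a b v w r s : leading a v r -> leading b w s -> a + b = 1 ->
  [\/ [/\ v = false, w = false & r + s = 1], w = false /\ s = 1,
      v = false /\ r = 1 | v = w /\ s = - r].
Proof.
move=> La Lb ab; have := La; move=> [n [m [p [q [p0 q0 E rE vE]]]]].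
have b0 : b != 0.
  apply/eqP => b0; case: Lb => n' [m' [p' [q' [p'0 q'0]]]].
  rewrite b0 mul0r => /esym/eqP; rewrite evalx_eq0 => /eqP/polyP/(_ n').
  by rewrite coef_XnM_eq coef0 => /eqP; rewrite (negPf p'0).
have bE : b * evalx ('X^m * q) = evalx ('X^m * q - 'X^n * p).
  by rewrite evalxB -E -[X in X - _]mul1r -ab mulrDl addrAC subrr add0r.
have Q0 : 'X^m * q != 0.
  by apply: contraNneq q0 => Q0; rewrite -(coef_XnM_eq m) Q0 coef0.
have : 'X^m * q - 'X^n * p != 0 by rewrite -evalx_eq0 -bE mulf_neq0 ?evalx_eq0.
case/poly_orderP => l [p' [BE p'0]].
have /(leading_inj Lb) [wE sE] : leading b (odd (l + m)) (p'`_0 / q`_0).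
  by exists l, m, p', q; rewrite -BE.
have := @poly_order_add _ n l m p p' q p0 p'0 q0.
rewrite -BE addrCA subrr addr0 => /(_ erefl) [[nm lm pq]|[_ lm pq]|[nm _ pq]|[nl _ pq]].
- by constructor 1; rewrite vE wE nm lm addnn odd_double rE sE -mulrDl pq mulfV.
- by constructor 2; rewrite wE sE lm addnn odd_double pq mulfV.
- by constructor 3; rewrite vE rE nm addnn odd_double pq mulfV.
- by constructor 4; rewrite vE wE rE sE nl pq mulNr opprK.
Qed.

Definition minus_one : nonzero k :=
  exist _ (- 1) (eq_ind_r (fun b : bool => ~~ b) (oner_neq0 k) (oppr_eq0 (1 : k))).

(* With Xi = tame_xi, the matrices a + b Xi form the algebra
   K[Xi] / (Xi^2 = {-1} Xi), where {x} can be sent to Xi. *)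
Definition tame_xi : 'M[milnorK k]_2 :=
  \matrix_(i, j) (if i == 0 then 0 else if j == 0 then 1 else sym minus_one).

Lemma tame_xi_sq : tame_xi *m tame_xi = (sym minus_one)%:M *m tame_xi.
Proof.
apply/matrixP => i j; rewrite mul_scalar_mx !mxE big_ord_recl big_ord1 !mxE /=.
case: (i == 0); first by rewrite !mul0r mulr0 addr0.
by rewrite mulr0 add0r; case: (j == 0); rewrite ?mulr1.
Qed.

Lemma scalar_comm (a : milnorK k) (M : 'M[milnorK k]_2) : a%:M *m M = M *m a%:M.
Proof.
apply/matrixP => i j; rewrite mul_scalar_mx !mxE (bigD1 j) //= !mxE eqxx mulr1n.
rewrite big1 ?addr0; first exact: milnorKC.
by move=> l lj; rewrite !mxE (negPf lj) mulr0n mulr0.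
Qed.

(** The image of {x^n u} with r = u(0): it is {r} + n Xi, where only the parity b of n matters. *)
Definition tame_val (r : nonzero k) (b : bool) : 'M[milnorK k]_2 :=
  (sym r)%:M + tame_xi *+ b.

Lemma mx_milnorK_add2 n (M : 'M[milnorK k]_n) : M + M = 0.
Proof. by apply/matrixP => i j; rewrite !mxE milnorK_add2. Qed.

Lemma tame_val_1 (r : nonzero k) : val r = 1 -> tame_val r false = 0.
Proof. by move=> r1; rewrite /tame_val sym_eq1 // raddf0 add0r. Qed.

(** Both {r}{-r} and {r} + {-r} + {-1} vanish, and Xi^2 = {-1} Xi turns the latter into the
    coefficient of Xi. *)
Lemma tame_val_opp (r s : nonzero k) v : val s = - val r ->
  tame_val r v * tame_val s v = 0.
Proof.
move=> sr; rewrite /tame_val -[LHS]/(_ *m _).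
have rs : (sym r)%:M *m (sym s)%:M = 0 :> 'M_2.
  by rewrite -scalar_mxM sym_opp // raddf0.
case: v; rewrite ?addr0 // mulmxDl !mulmxDr rs add0r tame_xi_sq.
rewrite -scalar_comm -!mulmxDl -!(raddfD (@scalar_mx _ 2)) /=.
have -> : sym s = sym r + sym minus_one by apply: symM; rewrite sr /= mulrN1.
by rewrite -addrA milnorK_add2 addr0 milnorK_add2 raddf0 mul0mx.
Qed.

Lemma tame_val_steinberg (r s : nonzero k) (v w : bool) :
  [\/ [/\ v = false, w = false & val r + val s = 1], w = false /\ val s = 1,
      v = false /\ val r = 1 | v = w /\ val s = - val r] ->
  tame_val r v * tame_val s w = 0.
Proof.
case=> [[-> -> rs]|[-> s1]|[-> r1]|[-> sr]].
- by rewrite /tame_val !addr0 -[LHS]/(_ *m _) -scalar_mxM sym_steinberg // raddf0.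
- by rewrite (tame_val_1 s1) mulr0.
- by rewrite (tame_val_1 r1) mul0r.
- exact: tame_val_opp.
Qed.

Lemma tame_hom : exists theta : {rmorphism milnorK F -> 'M[milnorK k]_2},
  forall (a : nonzero F) b (r : nonzero k), leading (val a) b (val r) ->
    theta (sym a) = tame_val r b.
Proof.
have /choice [e eE] : forall a : nonzero F, exists br : bool * nonzero k,
    leading (val a) br.1 (val br.2).
  move=> a; have [b [r Lr]] := leading_exists (valP a).
  by exists (b, exist _ r (leading_neq0 Lr)).
have uniq (a : nonzero F) b (r : nonzero k) : leading (val a) b (val r) -> e a = (b, r).
  move=> /(leading_inj (eE a)) [be re]; rewrite [LHS]surjective_pairing be.
  by congr (_, _); apply: val_inj.
have [|||theta thetaE] := @milnorK_lift F _ (fun a => tame_val (e a).2 (e a).1).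
- exact: mx_milnorK_add2.
- move=> a b c abc; have La := eE a; have Lb := eE b.
  have Lc := leadingM La Lb; have r0 := leading_neq0 Lc.
  rewrite -abc in Lc; rewrite (uniq c _ (exist _ (val (e a).2 * val (e b).2) r0) Lc) /tame_val /=.
  rewrite (@symM _ (e a).2 (e b).2) // raddfD /= addrACA; congr (_ + _).
  case: (e a).1; case: (e b).1; rewrite /= ?mulr0n ?addr0 ?add0r //.
  by rewrite mx_milnorK_add2.
- move=> a b ab; apply: tame_val_steinberg.
  exact: leading_steinberg (eE a) (eE b) ab.
- by exists theta => a b r Lr; rewrite thetaE (uniq a b r Lr).
Qed.

(* The specialization at x = 0 with respect to the uniformizer x is the upper
   left entry of tame_hom. *)
Lemma pure_symbol_specialize (s : seq (nonzero F * nonzero k)) :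
  (forall ar, ar \in s -> exists b, leading (val ar.1) b (val ar.2)) ->
  pure_symbol [seq ar.2 | ar <- s] <> 0 -> pure_symbol [seq ar.1 | ar <- s] <> 0.
Proof.
have [theta thetaE] := tame_hom => sL.
(* The matrices a + b Xi are lower triangular; the vanishing of the entry (0, 1) is carried along
   because it makes the entry (0, 0) multiplicative. *)
suff /(_ s sL) [_ E] : forall s : seq (nonzero F * nonzero k),
    (forall ar, ar \in s -> exists b, leading (val ar.1) b (val ar.2)) ->
    theta (pure_symbol [seq ar.1 | ar <- s]) 0 1 = 0 /\
    theta (pure_symbol [seq ar.1 | ar <- s]) 0 0 = pure_symbol [seq ar.2 | ar <- s].
  by move=> nz a0; apply: nz; rewrite -E a0 rmorph0 mxE.
elim=> [|[a r] t IHt] L.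
  by rewrite !pure_symbol_nil rmorph1 !mxE.
have [b Lab] := L _ (mem_head _ _).
have [ar artE|t01 t00] := IHt; first by apply: L; rewrite inE artE orbT.
rewrite /= !pure_symbol_cons rmorphM (thetaE a b r Lab) -[_ * _]/(_ *m _).
rewrite !mxE !big_ord_recl !big_ord0 !addr0 /= (_ : lift ord0 ord0 = 1); last exact: val_inj.
have E0 j : tame_xi 0 j = 0 by rewrite mxE.
have -> : tame_val r b 0 1 = 0 by rewrite /tame_val mxE mulmxnE E0 mul0rn addr0 mxE.
have -> : tame_val r b 0 0 = sym r by rewrite /tame_val mxE mulmxnE E0 mul0rn addr0 mxE.
by rewrite t01 t00 mulr0 !mul0r !addr0.
Qed.

(** Constants are units at x = 0 and specialize to themselves. *)
Lemma pure_symbol_base_change (s : seq (nonzero k)) :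
  pure_symbol s <> 0 -> pure_symbol (map (base_change iota) s) <> 0.
Proof.
move=> s0; pose t := [seq (base_change iota a, a) | a <- s].
have := @pure_symbol_specialize t; rewrite -!map_comp map_id; apply=> //.
by move=> _ /mapP [a _ ->]; exists false; exact: leading_const (valP a).
Qed.

(** The residue at x = 0 recovers [s]: the image under [theta] is [pure_symbol s] times Xi, and the
    entry (1, 0) of Xi is 1. *)
Lemma pure_symbol_ramified (s : seq (nonzero k)) (a : nonzero F) : val a = x ->
  pure_symbol s <> 0 -> pure_symbol (a :: map (base_change iota) s) <> 0.
Proof.
move=> ax s0; have [theta thetaE] := tame_hom.
have thetaC : theta (pure_symbol (map (base_change iota) s)) = (pure_symbol s)%:M.
  elim: s {s0} => [|c s IHs]; first by rewrite /= !pure_symbol_nil rmorph1.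
  rewrite /= !pure_symbol_cons rmorphM IHs (thetaE _ false c) /tame_val ?addr0 ?scalar_mxM //.
  exact: leading_const (valP c).
pose s1 : nonzero k := exist _ 1 (oner_neq0 k).
move=> /(congr1 theta); rewrite pure_symbol_cons rmorphM thetaC rmorph0.
rewrite (thetaE a true s1); last by rewrite ax; exact: leading_x.
rewrite /tame_val sym_eq1 // raddf0 add0r -[_ * _]/(_ *m _) -scalar_comm mul_scalar_mx.
by move/matrixP/(_ 1 0); rewrite !mxE /= mulr1.
Qed.
End Tame.

(** * Field extensions *)

Section FieldExtensions.

Lemma exists_irreducible_factor (k : fieldType) (p : {poly k}) :
  (1 < size p)%N -> exists2 q, irreducible_poly q & q %| p.
Proof.
have [n] := ubnP (size p); elim: n p => // n IHn p le_pn p1.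
have [irr|red] := pselect (irreducible_poly p); first by exists p.
have [q [q1 qp nqp]] : exists q : {poly k}, [/\ size q != 1, q %| p & ~~ (q %= p)].
  apply: contrapT => H; apply: red; split=> // q q1 qp.
  by apply/negPn/negP => nqp; apply: H; exists q.
have p0 : p != 0 by rewrite -size_poly_gt0 ltnW.
have q0 : q != 0 by apply: dvdpN0 qp p0.
have ltqp : (size q < size p)%N.
  by rewrite ltn_neqAle dvdp_leq // andbT dvdp_size_eqp.
have [||r irr_r rq] := IHn q; first exact: leq_trans ltqp le_pn.
  by rewrite ltn_neqAle eq_sym q1 size_poly_gt0.
by exists r => //; exact: dvdp_trans rq qp.
Qed.

Lemma exists_root_extension (k : fieldType) (p : {poly k}) : (1 < size p)%N ->
  exists (M : fieldType) (j : {rmorphism k -> M}) (z : M), root (map_poly j p) z.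
Proof.
case/exists_irreducible_factor => q /irredp_FAdjoin [L _ [z rz _]] qp.
exists L, (GRing.in_alg L), z; move: rz; rewrite -!dvdp_XsubCl => /dvdp_trans; apply.
by rewrite dvdp_map.
Qed.

Lemma exists_sqrt_extension (k : fieldType) (a : k) :
  exists (M : fieldType) (j : {rmorphism k -> M}) (z : M), z ^+ 2 = j a.
Proof.
have [|M [j [z rz]]] := @exists_root_extension k ('X^2 - a%:P).
  by rewrite size_XnsubC.
exists M, j, z; apply/eqP; rewrite -subr_eq0.
by move: rz; rewrite rmorphB /= map_polyXn map_polyC /root hornerD hornerN hornerXn hornerC.
Qed.

(* By Hensel if z is a root of P, and by choosing the value s of the new root
   at z otherwise. *)
Lemma sqrt_mod_step (M : fieldType) (P f g : {poly M}) (z s : M) :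
  2%:R != 0 :> M -> P %| g ^+ 2 - f -> s ^+ 2 = f.[z] -> f.[z] != 0 ->
  exists g', P * ('X - z%:P) %| g' ^+ 2 - f.
Proof.
move=> two0 /dvdpP [h hE] sE fz0.
(* Replacing g by g + c P changes the quotient h into h + 2 c g + c^2 P, and c is chosen to make
   this vanish at z. *)
have E c : (g + c%:P * P) ^+ 2 - f = P * (h + 2%:R * c%:P * g + c%:P ^+ 2 * P).
  have -> : (g + c%:P * P) ^+ 2 - f = g ^+ 2 - f + (2%:R * c%:P * g * P + c%:P ^+ 2 * P ^+ 2).
    by ring.
  by rewrite hE; ring.
have ev c : (h + 2%:R * c%:P * g + c%:P ^+ 2 * P).[z] =
    h.[z] + 2%:R * c * g.[z] + c ^+ 2 * P.[z].
  rewrite -polyC_natr -!rmorphXn -!polyCM !hornerD.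
  by congr (_ + _ + _); rewrite hornerM hornerC.
suff [c cz] : exists c, (h + 2%:R * c%:P * g + c%:P ^+ 2 * P).[z] = 0.
  by exists (g + c%:P * P); rewrite E dvdp_mul // dvdp_XsubCl; apply/rootP.
have [Pz|Pz] := eqVneq P.[z] 0.
  have gz : g.[z] != 0.
    have /(congr1 (horner^~ z)) := hE.
    rewrite hornerM Pz mulr0 hornerD hornerN horner_exp => /eqP.
    by rewrite subr_eq0 => /eqP gf; apply: contraNneq fz0 => gz; rewrite -gf gz expr0n.
  exists (- h.[z] / (2%:R * g.[z])).
  rewrite ev Pz mulr0 addr0.
  by field; rewrite two0 gz.
exists ((s - g.[z]) / P.[z]); apply: (mulfI Pz); rewrite mulr0 -hornerM -E.
rewrite !hornerE divfK // subrKC.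
by rewrite sE subrr.
Qed.

(** One linear factor of [P] is split off at a time, over a field containing a root z of [P] and a
    square root of f(z). Coprimality gives f(z) != 0, which allows for repeated roots. *)
Lemma exists_sqrt_mod (k : fieldType) (P f : {poly k}) :
  (2%:R != 0 :> k) -> P != 0 -> coprimep P f ->
  exists (M : fieldType) (j : {rmorphism k -> M}) (g : {poly M}),
    map_poly j P %| g ^+ 2 - map_poly j f.
Proof.
have [n] := ubnP (size P); elim: n k P f => // n IHn k P f le_Pn two0 P0 Pf.
have [P1|P1] := leqP (size P) 1.
  exists k, idfun, 0; rewrite map_poly_id //.
  have PE : P = (P`_0)%:P by exact: size1_polyC.
  have c0 : P`_0 != 0 by apply: contraNneq P0 => P00; rewrite PE P00.
  rewrite PE; apply: dvdp_trans (dvd1p _).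
  by rewrite dvdp1 size_polyC c0.
have [M1 [j1 [z rz]]] := exists_root_extension P1.
have [P' PE] := factor_theorem _ _ rz.
have P1' : map_poly j1 P != 0 by rewrite map_poly_eq0.
have P'0 : P' != 0 by apply: contraNneq P1' => P'0; rewrite PE P'0 mul0r.
have cop : coprimep (map_poly j1 P) (map_poly j1 f) by rewrite coprimep_map.
move: (cop); rewrite PE coprimepMl => /andP [P'f zf].
have [||M2 [j2 [g gP]]] := IHn M1 P' (map_poly j1 f) _ _ P'0 P'f.
- have : size (map_poly j1 P) = (size P').+1 by rewrite PE size_Mmonic ?monicXsubC // size_XsubC addn2.
  by rewrite size_map_poly => sP; rewrite sP in le_Pn.
- by rewrite -(rmorph_nat j1) fmorph_eq0.
have [M3 [j3 [s sE]]] := exists_sqrt_extension (map_poly j2 (map_poly j1 f)).[j2 z].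
pose j := j3 \o (j2 \o j1) : {rmorphism k -> M3}.
have jE p : map_poly j p = map_poly j3 (map_poly j2 (map_poly j1 p)).
  by rewrite /j !map_poly_comp.
have [||||g' g'P] := @sqrt_mod_step M3 (map_poly j3 (map_poly j2 P')) (map_poly j f)
   (map_poly j3 g) (j3 (j2 z)) s.
- by rewrite -(rmorph_nat j) fmorph_eq0.
- by rewrite jE -rmorphXn -rmorphB dvdp_map.
- by rewrite jE [RHS]horner_map.
- rewrite jE !horner_map !fmorph_eq0.
  by move: zf; rewrite coprimep_sym coprimep_XsubC rootE.
exists M3, j, g'; rewrite jE PE !rmorphM /=.
by rewrite !rmorphB /= !map_polyX !map_polyC.
Qed.

Local Notation "x %:F" := (@tofrac _ x).
Local Open Scope quotient_scope.

Lemma ratfun_is_rational (M : fieldType) :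
  is_rational_function_field (@tofrac {poly M} \o polyC : {rmorphism M -> {fraction {poly M}}}) 'X%:F.
Proof.
have ev p : (map_poly (@tofrac {poly M} \o polyC) p).['X%:F] = p%:F.
  by rewrite map_poly_comp horner_map -/(p \Po 'X) comp_polyXr.
split=> [p /eqP|y]; first by rewrite ev tofrac_eq0 => /eqP.
exists \n_(repr y), \d_(repr y); rewrite !ev tofrac_eq0 denom_ratioP; split=> //.
have d0 : (\d_(repr y))%:F != 0 :> {fraction {poly M}} by rewrite tofrac_eq0 denom_ratioP.
apply: (mulIf d0); rewrite divfK // -{1}[y]reprK.
rewrite !piE; apply/eqmodP; rewrite /= FracField.equivfE.
rewrite /FracField.mulf !numden_Ratio ?mulf_neq0 ?oner_neq0 ?denom_ratioP //.
by rewrite !(mulr1 (_ : {poly M})) mulrC.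
Qed.

(** The entries are variables adjoined one after the other; the residue at the last one reduces the
    length by 1. *)
Lemma exists_nonzero_symbol (M : fieldType) (n : nat) :
  exists (L : fieldType) (j : {rmorphism M -> L}) (s : seq (nonzero L)),
    size s = n /\ pure_symbol s <> 0.
Proof.
elim: n => [|n [L [j [s [sn s0]]]]].
  by exists M, idfun, [::]; split=> //; rewrite pure_symbol_nil; exact: milnorK1_neq0.
have X0 : 'X%:F != 0 :> {fraction {poly L}} by rewrite tofrac_eq0 polyX_eq0.
pose i := @tofrac {poly L} \o polyC : {rmorphism L -> {fraction {poly L}}}.
exists {fraction {poly L}}, (i \o j), (exist _ 'X%:F X0 :: map (base_change i) s).
by rewrite /= size_map sn; split=> //; apply: (pure_symbol_ramified (ratfun_is_rational L)).
Qed.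
End FieldExtensions.

(** * Morphisms out of a flexible field *)

Definition seq_eval (k0 : fieldType) (R : comNzRingType) (f : k0 -> R) n (u : nat -> R)
    (p : mpoly n k0) : R :=
  (map_mpoly f p).@[fun i : 'I_n => u i].

Section MpolyEval.
Variables (k0 : fieldType) (R : comNzRingType) (f : {rmorphism k0 -> R}).

Lemma seq_evalZ n u (c : k0) (p : mpoly n k0) :
  seq_eval f u (c *: p) = f c * seq_eval f u p.
Proof. exact: etrans (congr1 (meval _) (map_mpolyZ f c p)) (mevalZ _ _ _). Qed.

Lemma seq_eval_sum n u I (r : seq I) (p : I -> mpoly n k0) :
  seq_eval f u (\sum_(i <- r) p i) = \sum_(i <- r) seq_eval f u (p i).
Proof.
by rewrite /seq_eval (raddf_sum (map_mpoly f)) (raddf_sum (meval _)).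
Qed.

Lemma seq_eval_prod n u (I : finType) (p : I -> mpoly n k0) (m : I -> nat) :
  seq_eval f u (\prod_i p i ^+ m i) = \prod_i seq_eval f u (p i) ^+ m i.
Proof.
rewrite /seq_eval (rmorph_prod (map_mpoly f)) (rmorph_prod (meval _)).
by apply: eq_bigr => i _; rewrite !rmorphXn.
Qed.

Lemma seq_evalX n u (i : 'I_n) : seq_eval f u 'X_i = u i.
Proof. by rewrite /seq_eval map_mpolyX mevalXU. Qed.

(** Two elements of a flexible field can thus be written in the same number of variables. *)
Lemma seq_eval_widen n n' (le_nn' : (n <= n')%N) u (p : mpoly n k0) :
  seq_eval f u (p \mPo [tuple 'X_(widen_ord le_nn' i) | i < n]) = seq_eval f u p.
Proof.
rewrite [in RHS](mpolyE p) comp_mpolyE !seq_eval_sum; apply: eq_bigr => m _.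
rewrite !seq_evalZ mpolyXE_id !seq_eval_prod; congr (_ * _); apply: eq_bigr => i _.
by rewrite tnth_mktuple !seq_evalX.
Qed.
Lemma seq_evalE n u (p : mpoly n k0) :
  seq_eval f u p = \sum_(m <- msupp p) f p@_m * \prod_(i < n) u i ^+ m i.
Proof.
rewrite {1}(mpolyE p) seq_eval_sum; apply: eq_bigr => m _.
rewrite seq_evalZ mpolyXE_id seq_eval_prod; congr (_ * _).
by apply: eq_bigr => i _; rewrite seq_evalX.
Qed.
End MpolyEval.

Lemma seq_eval_rmorph (k0 : fieldType) (R S : comNzRingType) (f : {rmorphism k0 -> R})
    (h : {rmorphism R -> S}) (u : nat -> R) (v : nat -> S) n (p : mpoly n k0) :
  (forall i, (i < n)%N -> v i = h (u i)) ->
  seq_eval (h \o f) v p = h (seq_eval f u p).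
Proof.
move=> vE; rewrite !seq_evalE rmorph_sum; apply: eq_bigr => m _.
rewrite rmorphM rmorph_prod; congr (_ * _).
by apply: eq_bigr => i _; rewrite rmorphXn vE.
Qed.

Section GenericHom.
Variables (k0 k O : fieldType) (i0 : {rmorphism k0 -> k}) (g : {rmorphism k0 -> O}).
Variables (t : nat -> k) (s : nat -> O).
Hypothesis t_free : forall n (p : mpoly n k0), seq_eval i0 t p = 0 -> p = 0.
Hypothesis t_gen : forall y : k, exists n (p q : mpoly n k0),
  seq_eval i0 t q != 0 /\ y = seq_eval i0 t p / seq_eval i0 t q.
Hypothesis s_free : forall n (p : mpoly n k0), seq_eval g s p = 0 -> p = 0.

(** The graph of the morphism on k0[t_0, t_1, ...]; [frel] extends it to fractions. *)
Let rel a a' := exists n (p : mpoly n k0), a = seq_eval i0 t p /\ a' = seq_eval g s p.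

Let rel_common a a' b b' : rel a a' -> rel b b' -> exists n (p q : mpoly n k0),
  [/\ a = seq_eval i0 t p, a' = seq_eval g s p, b = seq_eval i0 t q & b' = seq_eval g s q].
Proof.
move=> [n [p [-> ->]]] [m [q [-> ->]]]; exists (maxn n m).
exists (p \mPo [tuple 'X_(widen_ord (leq_maxl n m) i) | i < n]).
exists (q \mPo [tuple 'X_(widen_ord (leq_maxr n m) i) | i < m]).
by rewrite !seq_eval_widen.
Qed.

Let relB a a' b b' : rel a a' -> rel b b' -> rel (a - b) (a' - b').
Proof.
move=> /rel_common/[apply] -[n [p [q [-> -> -> ->]]]].
by exists n, (p - q); rewrite /seq_eval !rmorphB /=.
Qed.

Let relM a a' b b' : rel a a' -> rel b b' -> rel (a * b) (a' * b').
Proof.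
move=> /rel_common/[apply] -[n [p [q [-> -> -> ->]]]].
by exists n, (p * q); rewrite /seq_eval !rmorphM /=.
Qed.

Let rel1 : rel 1 1.
Proof. by exists 0, 1; rewrite /seq_eval !rmorph1. Qed.

Let rel_eq0 a a' : rel a a' -> (a == 0) = (a' == 0).
Proof.
move=> [n [p [-> ->]]]; apply/eqP/eqP => [/t_free ->|/s_free ->];
  by rewrite /seq_eval !rmorph0.
Qed.

Let frel y y' := exists a a' b b',
  [/\ rel a a', rel b b', b != 0, y = a / b & y' = a' / b'].

Let frel_exists y : exists y', frel y y'.
Proof.
have [n [p [q [q0 ->]]]] := t_gen y; exists (seq_eval g s p / seq_eval g s q).
exists (seq_eval i0 t p), (seq_eval g s p), (seq_eval i0 t q), (seq_eval g s q).
by split=> //; [exists n, p | exists n, q].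
Qed.

Let frel_inj y y1 y2 : frel y y1 -> frel y y2 -> y1 = y2.
Proof.
move=> [a [a' [b [b' [Ra Rb b0 -> ->]]]]] [c [c' [d [d' [Rc Rd d0 E ->]]]]].
have b'0 : b' != 0 by rewrite -(rel_eq0 Rb).
have d'0 : d' != 0 by rewrite -(rel_eq0 Rd).
apply/eqP; rewrite eqr_div // -subr_eq0 -(rel_eq0 (relB (relM Ra Rd) (relM Rc Rb))).
by rewrite subr_eq0 -eqr_div // E.
Qed.

Let frelB x x' y y' : frel x x' -> frel y y' -> frel (x - y) (x' - y').
Proof.
move=> [a [a' [b [b' [Ra Rb b0 -> ->]]]]] [c [c' [d [d' [Rc Rd d0 -> ->]]]]].
have b'0 : b' != 0 by rewrite -(rel_eq0 Rb).
have d'0 : d' != 0 by rewrite -(rel_eq0 Rd).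
exists (a * d - c * b), (a' * d' - c' * b'), (b * d), (b' * d').
split; [exact: relB (relM _ _) (relM _ _) | exact: relM | exact: mulf_neq0 | |].
- by field; rewrite b0 d0.
- by field; rewrite b'0 d'0.
Qed.

Let frelM x x' y y' : frel x x' -> frel y y' -> frel (x * y) (x' * y').
Proof.
move=> [a [a' [b [b' [Ra Rb b0 -> ->]]]]] [c [c' [d [d' [Rc Rd d0 -> ->]]]]].
exists (a * c), (a' * c'), (b * d), (b' * d').
by split; [exact: relM | exact: relM | exact: mulf_neq0 | exact: mulf_div | exact: mulf_div].
Qed.

(** [k] is the field of fractions of k0[t_0, t_1, ...]. Sending t_i to s_i extends to it because the
    s_i are algebraically independent: nonzero denominators stay nonzero. *)
Lemma generic_hom : exists e : {rmorphism k -> O},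
  forall n (p : mpoly n k0), e (seq_eval i0 t p) = seq_eval g s p.
Proof.
have [e eP] := choice frel_exists.
have eE x x' : frel x x' -> e x = x' by exact: frel_inj (eP x).
have eB : zmod_morphism e by move=> x y; apply/eE/frelB.
have r1 a a' : rel a a' -> frel a a'.
  by move=> Ra; exists a, a', 1, 1; split; rewrite ?oner_neq0 ?divr1.
have eM : monoid_morphism e.
  by split=> [|x y]; [apply/eE/r1 | apply/eE/frelM].
pose eR : {rmorphism k -> O} :=
  HB.pack e (GRing.isZmodMorphism.Build _ _ e eB) (GRing.isMonoidMorphism.Build _ _ e eM).
by exists eR => n p; apply/eE/r1; exists n, p.
Qed.
End GenericHom.

(** * Expansion in squares of polynomials *)

Section SquareCoordinates.
Variable R : fieldType.
Hypothesis two0 : 2%:R != 0 :> R.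

(* The squares of these polynomials for i < 2 e + 1 form a basis of the
   polynomials of degree at most 2 e, with coordinates square_coord. *)
Definition square_base (i : nat) : {poly R} :=
  'X^(i./2) * (if odd i then 1 + 'X else 1).

(** The square for odd i is X^(i-1) + 2 X^i + X^(i+1): the coefficient r_i gives the coordinate r_i
    / 2, which is then subtracted from both even neighbours. *)
Definition square_coord (r : {poly R}) (i : nat) : R :=
  if odd i then r`_i / 2%:R else r`_i - r`_i.+1 / 2%:R - (if i is i'.+1 then r`_i' / 2%:R else 0).

Lemma square_coordD r r' i :
  square_coord (r + r') i = square_coord r i + square_coord r' i.
Proof.
rewrite /square_coord !coefD; case: (odd i); first exact: mulrDl.
by case: i => [|i]; rewrite ?coefD; ring.
Qed.

Lemma square_coordZ c r i : square_coord (c *: r) i = c * square_coord r i.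
Proof.
rewrite /square_coord !coefZ; case: (odd i); first by rewrite mulrA.
by case: i => [|i]; rewrite ?coefZ; ring.
Qed.

Lemma square_coordE e (r : {poly R}) : (size r <= e.*2.+1)%N ->
  r = \sum_(i < e.*2.+1) square_coord r i *: square_base i ^+ 2.
Proof.
elim: e r => [|e IHe] r sr.
  rewrite big_ord1 /square_coord /square_base /= !mulr1 expr1n subr0 alg_polyC.
  by rewrite [r`_1]nth_default ?mul0r ?subr0 //; apply: size1_polyC.
rewrite doubleS big_ord_recr big_ord_recr /=.
(* These are the coordinates of index 2e + 1 and 2e + 2. Removing their terms leaves [r'] of degree
   at most 2e. Its coefficient of degree 2e drops by a, which the coordinate of index 2e of [r]
   already subtracts. *)
pose a := r`_e.*2.+1 / 2%:R; pose b := r`_e.*2.+2 - a.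
pose r' := r - a *: ('X^(e.*2) + 2%:R *: 'X^(e.*2.+1) + 'X^(e.*2.+2)) - b *: 'X^(e.*2.+2).
have r'E n : r'`_n = r`_n - a * ((n == e.*2)%:R + 2%:R * (n == e.*2.+1)%:R + (n == e.*2.+2)%:R)
    - b * (n == e.*2.+2)%:R.
  by rewrite /r' !coefB !coefZ !coefD coefZ !coefXn.
have a2 : a * 2%:R = r`_e.*2.+1 by rewrite /a divfK.
have lo n : (n < e.*2)%N -> r'`_n = r`_n.
  move=> lt_n; have [n0 n1 n2] : [/\ n != e.*2, n != e.*2.+1 & n != e.*2.+2] by split; lia.
  by rewrite r'E (negPf n0) (negPf n1) (negPf n2) !(mulr0, addr0, subr0).
have hi : (size r' <= e.*2.+1)%N.
  apply/leq_sizeP => n le_n; rewrite r'E; have -> : (n == e.*2) = false by lia.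
  have [->|n1] := eqVneq n e.*2.+1.
    by rewrite ltn_eqF // !(mulr0, mulr1, addr0, subr0, add0r) a2 subrr.
  have [->|n2] := eqVneq n e.*2.+2.
    by rewrite !(mulr0, addr0, add0r, mulr1) /b subrr.
  have le_rn : (size r <= n)%N by lia.
  by rewrite (nth_default 0 le_rn) !mulr0 !addr0 !mulr0 !subr0.
have mid : r'`_e.*2 = r`_e.*2 - a.
  by rewrite r'E eqxx ltn_eqF // ltn_eqF // !mulr0 !addr0 mulr1 subr0.
have coordE i : (i < e.*2.+1)%N -> square_coord r' i = square_coord r i.
  rewrite ltnS leq_eqVlt => /orP [/eqP ->|lt_i]; rewrite /square_coord.
    rewrite odd_double mid (nth_default 0 hi) mul0r subr0 -/a; congr (_ - _).
    by case E : e.*2 => [//|n]; rewrite lo // E.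
  rewrite !(lo i) //; case: ifP => // odd_i; congr (_ - _ - _).
    rewrite lo // ltn_neqAle lt_i andbT; apply: contraFneq odd_i => /(congr1 odd) /=.
    by rewrite odd_double => /negbFE.
  by case: i lt_i {odd_i} => // n lt_n; rewrite lo // ltnW.
have -> : square_coord r e.*2.+1 = a by rewrite /square_coord /= odd_double.
have -> : square_coord r e.*2.+2 = b.
  by rewrite /square_coord /= odd_double /= (nth_default 0 sr) mul0r subr0.
transitivity (r' + (a *: ('X^(e.*2) + 2%:R *: 'X^(e.*2.+1) + 'X^(e.*2.+2)) + b *: 'X^(e.*2.+2))).
  by rewrite /r' addrA addrAC subrK subrK.
rewrite -[RHS]addrA; congr (_ + (_ *: _ + _ *: _)).
- by rewrite [LHS](IHe r' hi); apply: eq_bigr => i _; rewrite coordE.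
- have -> : square_base e.*2.+1 = 'X^e * (1 + 'X).
    by rewrite /square_base /= odd_double /= uphalf_double.
  rewrite exprMn -exprM muln2 !exprS -mul_polyC polyC_natr.
  by move: ('X^(e.*2)) => A; ring.
- by rewrite /square_base -doubleS doubleK odd_double mulr1 -exprM muln2.
Qed.
End SquareCoordinates.

(** * Linear equations and square coordinates in bounded degree *)

Section SmallSolutions.
Variables (L : fieldType) (e : nat).

Lemma size_quotient_le (a b c : {poly L}) :
  size a = e.+2 -> a * b = c -> (size c <= e.*2.+1)%N -> (size b <= e)%N.
Proof.
move=> sa <-; have [->|b0] := eqVneq b 0; first by rewrite size_poly0.
have a0 : a != 0 by rewrite -size_poly_gt0 sa.
by rewrite size_mul // sa !addSn /= -addnn -addSn leq_add2l.
Qed.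

(** y is reduced modulo a, and comparing degrees then bounds z. For a = P and b = 2 g, this makes
    the differential (y, z) |-> 2 g y + P z of u^2 - f + P h surjective onto degree at most 2e. *)
Lemma bezout_small (a b c : {poly L}) : coprimep a b -> size a = e.+2 ->
  (size b <= e.+1)%N -> (size c <= e.*2.+1)%N ->
  exists y z, [/\ b * y + a * z = c, (size y <= e.+1)%N & (size z <= e)%N].
Proof.
move=> /Bezout_eq1_coprimepP [[u v] /= uv] sa sb sc.
have a0 : a != 0 by rewrite -size_poly_gt0 sa.
pose y := (v * c) %% a; have sy : (size y <= e.+1)%N.
  by rewrite -ltnS -sa ltn_modp.
have : a %| c - b * y.
  rewrite -[X in X - _](mul1r c) -uv.
  have -> : (u * a + v * b) * c - b * y = a * (u * c) + b * (v * c - y) by ring.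
  rewrite dvdp_add ?dvdp_mulIl // dvdp_mull //.
  by rewrite [X in X - _](divp_eq _ a) addrK dvdp_mulIr.
case/dvdpP => z zE; exists y, z; split=> //; first by rewrite [a * z]mulrC -zE subrKC.
apply: (size_quotient_le sa (c := c - b * y)); first by rewrite zE mulrC.
rewrite (leq_trans (size_polyD _ _)) // size_polyN geq_max sc /=.
rewrite (leq_trans (size_polyMleq _ _)) // -addnn.
by rewrite -subn1 leq_subLR add1n -addSn -addnS leq_add.
Qed.

Lemma square_coord_surj (tau : nat -> L) : 2%:R != 0 :> L ->
  (forall i, (e.*2 < i)%N -> tau i = 0) ->
  exists2 Z : {poly L}, (size Z <= e.*2.+1)%N &
    forall i, (i < e.*2.+1)%N -> square_coord Z i = tau i.
Proof.
(* These are the coefficients of the sum of the tau_i times the squares of [square_base]. *)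
move=> two0 tau0; pose c i := if odd i then 2%:R * tau i
  else tau i + tau i.+1 + (if i is i'.+1 then tau i' else 0).
exists (\poly_(i < e.*2.+1) c i) => [|i lt_i]; first exact: size_poly.
rewrite /square_coord !coef_poly lt_i.
have [odd_i|odd_i] := boolP (odd i); first by rewrite /c odd_i mulrAC divff ?mul1r.
have -> : (if (i.+1 < e.*2.+1)%N then c i.+1 else 0) = 2%:R * tau i.+1.
  by rewrite /c /= odd_i; case: ltnP => // le_i; rewrite tau0 ?mulr0.
rewrite [X in _ - X - _]mulrAC divff // mul1r /c (negPf odd_i) [X in X - _]addrAC addrK.
case: i lt_i odd_i => [|i] lt_i odd_i; first by rewrite addr0 subr0.
rewrite coef_poly (ltnW lt_i) /c -[odd i]negbK odd_i.
by rewrite [X in _ - X]mulrAC divff // mul1r addrK.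
Qed.
End SmallSolutions.

(** * Moving the fresh variables along a path *)

Section LowVariables.
Variables (k0 k : fieldType) (i0 : {rmorphism k0 -> k}) (t : nat -> k).

(** The subfield k0(t_0, ..., t_(m-1)); later variables are fresh for its elements. *)
Definition in_first m (y : k) := exists p q : mpoly m k0,
  seq_eval i0 t q != 0 /\ y = seq_eval i0 t p / seq_eval i0 t q.

Lemma in_first_widen m m' y : (m <= m')%N -> in_first m y -> in_first m' y.
Proof.
move=> le_mm' [p [q [q0 ->]]].
exists (p \mPo [tuple 'X_(widen_ord le_mm' i) | i < m]).
exists (q \mPo [tuple 'X_(widen_ord le_mm' i) | i < m]).
by rewrite !seq_eval_widen.
Qed.

Lemma in_first_poly (p : {poly k}) : (forall y, exists m, in_first m y) ->
  exists m, forall i, in_first m p`_i.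
Proof.
move=> /choice [b bP]; exists (\max_(i < size p) b (p`_i)%R) => i.
have [lt_i|le_i] := ltnP i (size p).
  apply: in_first_widen (bP _); exact: (@leq_bigmax _ (fun i : 'I_(size p) => b (p`_i)%R) (Ordinal lt_i)).
rewrite nth_default //; exists 0, 1.
by rewrite /seq_eval !rmorph0 !rmorph1 oner_neq0 mul0r.
Qed.
End LowVariables.

Lemma pure_symbol_base_change0 (k F : fieldType) (j : {rmorphism k -> F}) s :
  pure_symbol s = 0 -> pure_symbol (map (base_change j) s) = 0.
Proof.
have [|||phi phiE] := @milnorK_lift k (milnorK F) (fun a => sym (base_change j a)).
- exact: milnorK_add2.
- by move=> a b c abc; apply: symM; rewrite /= abc rmorphM.
- by move=> a b ab; apply: sym_steinberg; rewrite /= -rmorphD ab rmorph1.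
move=> /(congr1 phi); rewrite rmorph0 /pure_symbol rmorph_prod big_map => <-.
by apply: eq_bigr => a _; rewrite phiE.
Qed.

Lemma square_coord_map (k L : fieldType) (j : {rmorphism k -> L}) (r : {poly k}) i :
  square_coord (map_poly j r) i = j (square_coord r i).
Proof.
rewrite /square_coord !coef_map -(rmorph_nat j); case: (odd i).
  by rewrite fmorph_div.
by case: i => [|i]; rewrite ?coef_map !rmorphB !fmorph_div ?rmorph0.
Qed.

(** [eps] can move only the variables of index at least [m], so polynomials over k0(t_0, ...,
    t_(m-1)), such as f and P below, stay fixed along the path. *)
Lemma map_poly_low (k0 k L O : fieldType) (i0 : {rmorphism k0 -> k}) (J : {rmorphism k -> L})
    (iL : {rmorphism L -> O}) (eps : {rmorphism k -> O}) (t : nat -> k) (s : nat -> O) m (p : {poly k}) :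
  (forall n (q : mpoly n k0), eps (seq_eval i0 t q) = seq_eval (iL \o (J \o i0)) s q) ->
  (forall n, (n < m)%N -> s n = iL (J (t n))) -> (forall i, in_first i0 t m p`_i) ->
  map_poly eps p = map_poly iL (map_poly J p).
Proof.
move=> epsE sE lowp; apply/polyP => i; rewrite !coef_map /=.
have [a [b [b0 ->]]] := lowp i; rewrite !fmorph_div !epsE.
have E (q : mpoly m k0) : seq_eval (iL \o (J \o i0)) s q = iL (J (seq_eval i0 t q)).
  exact: (@seq_eval_rmorph _ _ _ i0 (iL \o J : {rmorphism k -> O}) t s m q sE).
by rewrite !E.
Qed.

(* The fresh coefficients of u and h move along a path which starts, at time 0,
   at an actual solution of u^2 - f + P h = 0 with direction (y, z). *)
Lemma square_coord_path (L O : fieldType) (iL : {rmorphism L -> O}) (x : O)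
    (P f g h y z w v : {poly L}) i :
  g ^+ 2 - f + P * h = 0 ->
  exists q : {poly L}, square_coord
    ((map_poly iL g + x%:P * map_poly iL y + x%:P ^+ 2 * map_poly iL w) ^+ 2 - map_poly iL f +
     map_poly iL P * (map_poly iL h + x%:P * map_poly iL z + x%:P ^+ 2 * map_poly iL v)) i =
  evalx iL x ('X * ((square_coord (2%:R *: g * y + P * z) i)%:P + 'X * q)).
Proof.
(* T0, T1 and T2 are the coefficients of x^2, x^3 and x^4; the constant one is zero by [E0], and
   that of x is 2 g y + P z. *)
move=> E0; have fE : f = g ^+ 2 + P * h by rewrite -[LHS]addr0 -E0; ring.
pose T0 := y ^+ 2 + 2%:R *: g * w + P * v; pose T1 := 2%:R *: y * w; pose T2 := w ^+ 2.
exists ((square_coord T0 i)%:P + (square_coord T1 i) *: 'X + (square_coord T2 i) *: ('X * 'X)).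
have -> : (map_poly iL g + x%:P * map_poly iL y + x%:P ^+ 2 * map_poly iL w) ^+ 2 - map_poly iL f +
     map_poly iL P * (map_poly iL h + x%:P * map_poly iL z + x%:P ^+ 2 * map_poly iL v) =
   x *: map_poly iL (2%:R *: g * y + P * z) + (x ^+ 2) *: map_poly iL T0
   + (x ^+ 3) *: map_poly iL T1 + (x ^+ 4) *: map_poly iL T2.
  rewrite /T0 /T1 /T2 fE -!mul_polyC !polyC_natr.
  rewrite !(rmorphD, rmorphM, rmorphXn, rmorph_nat) /=.
  by ring.
move: T0 T1 T2 (2%:R *: g * y + P * z) => T0 T1 T2 D.
rewrite !square_coordD !square_coordZ !square_coord_map.
rewrite !(evalxM, evalxD, evalxC, evalxX) -!mul_polyC !(evalxM, evalxD, evalxC, evalxX).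
by ring.
Qed.

(** The path starts at a with direction b, and the term in x^2 makes it reach c at x = 1. *)
Lemma poly_path (L O : fieldType) (iL : {rmorphism L -> O}) (x : O) (e : nat)
    (a b c : {poly L}) (U : {poly O}) :
  (size a <= e)%N -> (size b <= e)%N -> (size c <= e)%N -> (size U <= e)%N ->
  (forall l, (l < e)%N -> U`_l = iL a`_l + iL b`_l * x + iL (c`_l - a`_l - b`_l) * x ^+ 2) ->
  U = map_poly iL a + x%:P * map_poly iL b + x%:P ^+ 2 * map_poly iL (c - a - b).
Proof.
move=> sa sb sc sU UE; apply/polyP => l; rewrite -rmorphXn /= !coefD !coefCM !coef_map /= !coefB.
have [lt_l|le_l] := ltnP l e; first by rewrite UE // ![x * _]mulrC ![x ^+ 2 * _]mulrC.
by rewrite !nth_default ?(leq_trans _ le_l) // !subr0 rmorph0 !mulr0 !addr0.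
Qed.

(** The coefficients of u and h are the first fresh variables. A morphism from [k] to L(x) sends
    them to a path through a solution of u^2 - f + P h = 0 at x = 0, where each coordinate vanishes
    to order 1 with leading coefficient an entry of a nonzero symbol over L. *)
Lemma generic_values (k : fieldType) (e : nat) (f P : {poly k}) :
  flexible k -> 2%:R != 0 :> k -> size P = e.+2 -> coprimep P f -> (size f <= e.*2.+1)%N ->
  exists (u h : {poly k}) (s : seq (nonzero k * {poly k})), [/\ (size h <= e)%N,
    u ^+ 2 - f + P * h = \sum_(cp <- s) val cp.1 *: cp.2 ^+ 2 &
    pure_symbol [seq cp.1 | cp <- s] <> 0].
Proof.
move=> [k0 [i0 [t [t_free t_gen]]]] two0 sP Pf sf.
have [m [lowf lowP]] : exists m, (forall i, in_first i0 t m f`_i) /\ (forall i, in_first i0 t m P`_i).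
  have [m1 l1] := in_first_poly f t_gen; have [m2 l2] := in_first_poly P t_gen.
  exists (maxn m1 m2).
  by split=> i; [apply: in_first_widen (leq_maxl _ _) (l1 i) | apply: in_first_widen (leq_maxr _ _) (l2 i)].
have P0 : P != 0 by rewrite -size_poly_gt0 sP.
have [M [j1 [g1 g1P]]] := exists_sqrt_mod two0 P0 Pf.
have [L [j2 [sy [size_sy sy0]]]] := exists_nonzero_symbol M e.*2.+1.
pose J := j2 \o j1 : {rmorphism k -> L}.
have JE p : map_poly J p = map_poly j2 (map_poly j1 p) by rewrite /J map_poly_comp.
have two0L : 2%:R != 0 :> L by rewrite -(rmorph_nat J) fmorph_eq0.
pose Pl := map_poly J P; pose fl := map_poly J f; pose g := map_poly j2 g1 %% Pl.
have sPl : size Pl = e.+2 by rewrite size_map_poly.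
have Pl0 : Pl != 0 by rewrite map_poly_eq0.
have sg : (size g <= e.+1)%N by rewrite -ltnS -sPl ltn_modp.
have [h hE] : exists h : {poly L}, g ^+ 2 - fl + Pl * h = 0.
  have : Pl %| g ^+ 2 - fl.
    have : Pl %| map_poly j2 g1 ^+ 2 - fl.
      by rewrite /Pl /fl !JE -rmorphXn -rmorphB dvdp_map.
    rewrite [map_poly j2 g1](divp_eq _ Pl) -/g; set q := _ %/ _.
    have -> : (q * Pl + g) ^+ 2 - fl = (q ^+ 2 * Pl + 2%:R * q * g) * Pl + (g ^+ 2 - fl) by ring.
    by rewrite dvdp_addr // dvdp_mulIr.
  by case/dvdpP => h hE; exists (- h); rewrite hE; ring.
have PhE : Pl * h = fl - g ^+ 2 by apply: (addrI (g ^+ 2 - fl)); rewrite hE; ring.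
have sh : (size h <= e)%N.
  apply: (size_quotient_le sPl PhE).
  rewrite (leq_trans (size_polyD _ _)) // size_polyN geq_max size_map_poly sf /=.
  rewrite (leq_trans (size_polyMleq _ _)) // -subn1 leq_subLR add1n -addnn -addSn -addnS.
  exact: leq_add.
(* Modulo P, g^2 is f, which is prime to P. *)
have Plg : coprimep Pl (2%:R *: g).
  rewrite coprimepZr // -(@coprimep_pexpr _ 2) //.
  have -> : g ^+ 2 = (- h) * Pl + fl by rewrite mulNr mulrC PhE; ring.
  by rewrite coprimep_addl_mul /Pl /fl coprimep_map.
have one0 : 1 != 0 :> L by exact: oner_neq0.
pose ta n : nonzero L := nth (exist _ 1 one0) sy n.
pose tau n : L := if (n < e.*2.+1)%N then val (ta n) else 0.
have [Z sZ ZE] : exists2 Z : {poly L}, (size Z <= e.*2.+1)%N &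
    forall i, (i < e.*2.+1)%N -> square_coord Z i = tau i.
  by apply: square_coord_surj => // i lt_i; rewrite /tau ltnS leqNgt lt_i.
(* In the direction (y, z), the i-th coordinate has derivative the i-th entry of [sy]. *)
have [|y [z [yzE sy1 sz]]] := bezout_small Plg sPl _ sZ; first by rewrite size_scale.
pose iL := @tofrac {poly L} \o polyC : {rmorphism L -> {fraction {poly L}}}.
pose x : {fraction {poly L}} := tofrac 'X.
have ratL : is_rational_function_field iL x by exact: ratfun_is_rational.
(* [A] is the starting point and [B] the direction of the path of each variable. Those of index
   below m stay fixed, the next e + 1 are the coefficients of u, the next e those of h, and the
   remaining ones stay fixed. *)
pose A n : L := if (n < m)%N then J (t n) else if (n - m < e.+1)%N then g`_(n - m)
  else if (n - m - e.+1 < e)%N then h`_(n - m - e.+1) else J (t n).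
pose B n : L := if (n < m)%N then 0 else if (n - m < e.+1)%N then y`_(n - m)
  else if (n - m - e.+1 < e)%N then z`_(n - m - e.+1) else 0.
pose S n : {poly L} := (A n)%:P + (B n)%:P * 'X + (J (t n) - A n - B n)%:P * 'X ^+ 2.
pose s n : {fraction {poly L}} := tofrac (S n).
have sE n : s n = iL (A n) + iL (B n) * x + iL (J (t n) - A n - B n) * x ^+ 2.
  by rewrite /s /S !(rmorphD, rmorphM, rmorphXn).
have s_free n (p : mpoly n k0) : seq_eval (iL \o (J \o i0)) s p = 0 -> p = 0.
  rewrite (@seq_eval_rmorph _ _ _ (polyC \o (J \o i0)) (@tofrac {poly L}) S s n p) //.
  (* At x = 1 the path passes through the original variables, so the s_n are algebraically
     independent. *)
  have evS : horner_eval 1 (seq_eval (polyC \o (J \o i0)) S p) = J (seq_eval i0 t p).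
    rewrite -(@seq_eval_rmorph _ _ _ _ (horner_eval 1 : {rmorphism _ -> _}) S (J \o t)) => [|i _].
      rewrite -(@seq_eval_rmorph _ _ _ i0 J t (J \o t)) //.
      apply: (congr1 (fun F : k0 -> L => seq_eval F (J \o t) p)).
      by apply/funext => a; rewrite /= /horner_eval hornerC.
    rewrite /= /horner_eval /S !(hornerD, hornerM, hornerC, hornerX, hornerXn).
    by rewrite !mulr1 -[X in _ = _ + X]addrA -opprD subrKC.
  move/eqP; rewrite tofrac_eq0 => /eqP p0; move: evS; rewrite p0 rmorph0 => /esym/eqP.
  by rewrite fmorph_eq0 => /eqP /t_free.
have [eps epsE] := generic_hom t_free t_gen s_free.
have eps_t n : eps (t n) = s n.
  have := epsE n.+1 'X_ord_max; rewrite (seq_evalX i0 t) => ->.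
  exact: (seq_evalX (iL \o (J \o i0)) s).
have s_low n : (n < m)%N -> s n = iL (J (t n)).
  by move=> lt_n; rewrite sE /A /B lt_n subrr subr0 rmorph0 !mul0r !addr0.
pose u := \poly_(l < e.+1) t (m + l)%N.
pose v := \poly_(l < e) t (m + (e.+1 + l))%N.
have epsu : map_poly eps u = map_poly iL g + x%:P * map_poly iL y +
    x%:P ^+ 2 * map_poly iL (map_poly J u - g - y).
  apply: (poly_path (e := e.+1)); rewrite ?size_map_poly ?size_poly // => l lt_l.
  rewrite !coef_map /= coef_poly lt_l eps_t sE /A /B.
  by rewrite ltnNge leq_addr /= addKn lt_l.
have epsv : map_poly eps v = map_poly iL h + x%:P * map_poly iL z +
    x%:P ^+ 2 * map_poly iL (map_poly J v - h - z).
  apply: (poly_path (e := e)); rewrite ?size_map_poly ?size_poly // => l lt_l.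
  rewrite !coef_map /= coef_poly lt_l eps_t sE /A /B.
  by rewrite ltnNge leq_addr /= addKn ltnNge leq_addr /= addKn lt_l.
pose r := u ^+ 2 - f + P * v.
(* By the choice of (y, z), the i-th coordinate is x times a unit whose value at x = 0 is the i-th
   entry of [sy]. *)
have lead i : (i < e.*2.+1)%N -> leading iL x (eps (square_coord r i)) true (val (ta i)).
  move=> lt_i; rewrite -square_coord_map /r rmorphD rmorphB rmorphXn rmorphM /= epsu epsv.
  rewrite (map_poly_low epsE s_low lowf) (map_poly_low epsE s_low lowP).
  have [q ->] := square_coord_path iL x y z (map_poly J u - g - y) (map_poly J v - h - z) i hE.
  rewrite yzE ZE // /tau lt_i; set p := _ + _.
  have p0 : p`_0 = val (ta i) by rewrite coefD coefC coefXM addr0.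
  exists 1, 0, p, 1; rewrite p0 coef1 oner_neq0 (valP (ta i)) divr1 !mulr1; split=> //.
  by rewrite [evalx _ _ 1]evalxC rmorph1 mulr1 expr1.
have c0 (i : 'I_e.*2.+1) : square_coord r i != 0.
  apply/eqP => ri0; have := lead i (ltn_ord i); rewrite ri0 rmorph0.
  move=> [n [n' [p [q [p0 _ /esym/eqP]]]]]; rewrite mul0r (evalx_eq0 ratL).
  by move=> /eqP/polyP/(_ n); rewrite coef_XnM_eq coef0 => /eqP; rewrite (negPf p0).
pose c (i : 'I_e.*2.+1) : nonzero k := exist _ (square_coord r i) (c0 i).
exists u, v, [seq (c i, square_base k i) | i <- enum 'I_e.*2.+1].
split; first exact: size_poly.
  rewrite big_map big_enum; apply: square_coordE => //.
  rewrite (leq_trans (size_polyD _ _)) // geq_max; apply/andP; split.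
    rewrite (leq_trans (size_polyD _ _)) // size_polyN geq_max sf andbT.
    rewrite (leq_trans (size_polyMleq _ _)) // -subn1 leq_subLR add1n -addnn -addSn -addnS.
    by apply: leq_add; exact: size_poly.
  rewrite (leq_trans (size_polyMleq _ _)) // sP !addSn /= -addnn ltnS leq_add2l.
  exact: size_poly.
(* A zero symbol would remain zero under [eps], but its specialization at x = 0 is that of [sy]. *)
rewrite -map_comp => /(pure_symbol_base_change0 eps); rewrite -map_comp.
have := @pure_symbol_specialize _ _ iL x ratL
  [seq (base_change eps (c i), ta i) | i <- enum 'I_e.*2.+1].
rewrite -!map_comp; apply.
  by move=> _ /mapP [i _ ->]; exists true; exact: lead.
rewrite (_ : map _ _ = sy) //.
rewrite -[RHS](mkseq_nth (exist _ 1 one0)) size_sy /mkseq -val_enum_ord -map_comp.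
by rewrite [in RHS]enumT; apply: eq_map.
Qed.

(** * Vanishing in degrees at least 2 *)

Section Vanishing.
Variables (k F : fieldType) (iota : {rmorphism k -> F}) (x : F).
Hypothesis flex_k : flexible k.
Hypothesis two0 : 2%:R != 0 :> k.
Hypothesis ratF : is_rational_function_field iota x.

Local Notation A := (iso_milnorK iota).
Local Notation iso := (to_rquot (killed iota)).
Local Notation ev := (evalx iota x).

Lemma iso_killed (s : seq (nonzero k)) z : pure_symbol s <> 0 ->
  z * pure_symbol (map (base_change iota) s) = 0 -> iso z = 0.
Proof.
move=> s0 zs; apply/to_rquot_eq0; apply: zspan_gen.
by exists 1, z, 1; rewrite mul1r mulr1; split=> //; exists s.
Qed.

Lemma iso_milnorK_add2 (z : A) : z + z = 0.
Proof. by elim/to_rquot_ind: z => y; rewrite -rmorphD milnorK_add2 rmorph0. Qed.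

Lemma iso_milnorKC (y z : A) : y * z = z * y.
Proof.
elim/to_rquot_ind: y => y; elim/to_rquot_ind: z => z.
by rewrite -!rmorphM milnorKC.
Qed.

Lemma evalx_neq0 (p : {poly k}) : p != 0 -> ev p != 0.
Proof. by rewrite evalx_eq0. Qed.

(** The value 0 at the zero polynomial allows an induction on sizes without nonvanishing
    hypotheses. *)
Definition poly_sym (p : {poly k}) : A :=
  if insub (ev p) is Some a then iso_sym iota a else 0.

Lemma poly_symE (p : {poly k}) (a : nonzero F) : val a = ev p -> poly_sym p = iso (sym a).
Proof. by rewrite /poly_sym => <-; rewrite valK. Qed.

Lemma poly_sym0 : poly_sym 0 = 0.
Proof. by rewrite /poly_sym insubF // /evalx rmorph0 horner0 eqxx. Qed.

Lemma poly_symM p q : p != 0 -> q != 0 -> poly_sym (p * q) = poly_sym p + poly_sym q.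
Proof.
move=> p0 q0; have pq0 : p * q != 0 by rewrite mulf_neq0.
pose a p (p0 : p != 0) : nonzero F := exist _ (ev p) (evalx_neq0 p0).
rewrite (@poly_symE (p * q) (a _ pq0)) // (@poly_symE p (a _ p0)) // (@poly_symE q (a _ q0)) //.
by rewrite -rmorphD -(@symM _ (a _ p0) (a _ q0) (a _ pq0)) //= evalxM.
Qed.

(** If h = 0 then f is itself the value w annihilated by alpha; otherwise the Steinberg relation for
    w + P h = f is multiplied by alpha. *)
Lemma poly_sym_relation (e : nat) (f P : {poly k}) : size P = e.+2 -> coprimep P f ->
  (size f <= e.*2.+1)%N -> f != 0 -> exists h : {poly k}, [/\ (size h <= e)%N,
    h = 0 -> poly_sym f = 0 &
    h != 0 -> poly_sym f * (poly_sym P + poly_sym h + poly_sym f) = 0].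
Proof.
move=> sP Pf sf f0; have [u [h [s [sh uE s0]]]] := generic_values flex_k two0 sP Pf sf.
exists h; have P0 : P != 0 by rewrite -size_poly_gt0 sP.
(* P is nonconstant and prime to f, so f is not a multiple of P. *)
have w0 : f - P * h != 0.
  rewrite subr_eq0; apply: contraTneq Pf => ->.
  by rewrite coprimep_sym coprimepMl coprimepp sP.
pose w : nonzero F := exist _ (ev (f - P * h)) (evalx_neq0 w0).
pose sf' : nonzero F := exist _ (ev f) (evalx_neq0 f0).
pose alpha := pure_symbol (map (base_change iota) [seq cp.1 | cp <- s]).
have wa : sym w * alpha = 0.
  pose t := [seq (base_change iota cp.1, ev cp.2) | cp <- s].
  have := @sym_pfister_value F t (ev u) w; rewrite /alpha -!map_comp; apply.
  have -> : val w = ev (u ^+ 2 - \sum_(cp <- s) val cp.1 *: cp.2 ^+ 2).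
    by rewrite /= -uE; congr (ev _); ring.
  rewrite evalxB expr2 evalxM -expr2 big_map; congr (_ - _).
  elim: s {uE s0 alpha t} => [|cp s IHs]; first by rewrite !big_nil [ev 0]evalxC rmorph0.
  by rewrite !big_cons evalxD IHs -mul_polyC expr2 !evalxM evalxC.
split=> // [h0|h0].
  rewrite (@poly_symE f w); last by rewrite /= h0 mulr0 subr0.
  exact: iso_killed s0 wa.
have Ph0 : P * h != 0 by rewrite mulf_neq0.
pose sPh : nonzero F := exist _ (ev (P * h)) (evalx_neq0 Ph0).
rewrite -poly_symM // (@poly_symE (P * h) sPh) // (@poly_symE f sf') //.
rewrite -rmorphD -rmorphM; apply: iso_killed s0 _; rewrite -/alpha.
have wPf : (sym w + sym sf') * (sym sPh + sym sf') = 0.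
  by apply: sym_steinbergD; rewrite /= -evalxD subrK.
have : (sym w + sym sf') * (sym sPh + sym sf') * alpha = 0 by rewrite wPf mul0r.
by rewrite mulrDl mulrDl (milnorKC (sym w)) -[_ * sym w * _]mulrA wa mulr0 add0r.
Qed.

(** With P = X and e = 0, the size bound forces h = 0. *)
Lemma poly_symC c : poly_sym c%:P = 0.
Proof.
have [->|c0] := eqVneq c 0; first exact: poly_sym0.
have [||||h [+ hE _]] := @poly_sym_relation 0 c%:P 'X; rewrite ?size_polyX ?size_polyC_leq1 ?polyC_eq0 //.
  by rewrite coprimep_sym coprimepX /root hornerC.
by rewrite leqn0 size_poly_eq0 => /eqP.
Qed.

Lemma poly_symZ c p : c != 0 -> poly_sym (c *: p) = poly_sym p.
Proof.
move=> c0; have [->|p0] := eqVneq p 0; first by rewrite scaler0.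
by rewrite -mul_polyC poly_symM ?polyC_eq0 // poly_symC add0r.
Qed.

(** Constants have symbol 0, so {p}{p} = {p}{-p} = 0. *)
Lemma poly_sym_sq p : poly_sym p * poly_sym p = 0.
Proof.
have [->|p0] := eqVneq p 0; first by rewrite poly_sym0 mul0r.
have Np0 : - p != 0 by rewrite oppr_eq0.
pose a p (p0 : p != 0) : nonzero F := exist _ (ev p) (evalx_neq0 p0).
have -> : poly_sym p * poly_sym p = poly_sym p * poly_sym (- p).
  by rewrite -scaleN1r poly_symZ // oppr_eq0 oner_eq0.
rewrite (@poly_symE p (a _ p0)) // (@poly_symE (- p) (a _ Np0)) // -rmorphM sym_opp ?rmorph0 //.
by rewrite /= -sub0r evalxB [ev 0]evalxC rmorph0 sub0r.
Qed.

Lemma poly_sym_mul0 f g : poly_sym f * poly_sym g = 0.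
Proof.
move: {2}(maxn _ _) (leqnn (maxn (size f) (size g))) => d; rewrite geq_max => /andP[].
elim: d f g => [|d IHd] f g.
  by rewrite leqn0 size_poly_eq0 => /eqP ->; rewrite poly_sym0 mul0r.
case: d IHd => [|e] IHe sf sg; first by rewrite (size1_polyC sf) poly_symC mul0r.
(* The case of distinct degrees, with [P] of the top degree e + 1. *)
have lower (P p : {poly k}) : size P = e.+2 -> (size p <= e.+1)%N -> poly_sym P * poly_sym p = 0.
  move=> sP sp; have P0 : P != 0 by rewrite -size_poly_gt0 sP.
  have [->|p0] := eqVneq p 0; first by rewrite poly_sym0 mulr0.
  have [Pp|nPp] := boolP (coprimep P p).
    have [|h [sh h0 hn0]] := @poly_sym_relation e p P sP Pp _ p0.
      by apply: leq_trans sp _; rewrite -addnn -addSn leq_addr.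
    have [/h0 ->|/hn0] := eqVneq h 0; first by rewrite mulr0.
    (* In {p}({P} + {h} + {p}) = 0 the square vanishes, and {p}{h} does by induction. *)
    rewrite !mulrDr poly_sym_sq addr0 (iso_milnorKC _ (poly_sym h)) (IHe h p) ?(leqW sh) ?addr0 //.
    by rewrite iso_milnorKC.
  (* Otherwise [P] is the product of this gcd and its cofactor, both of smaller degree: the gcd is
     nonconstant and divides [p]. *)
  pose D := gcdp P p; have Dp : D %| p by exact: dvdp_gcdr.
  have sD : (size D <= e.+1)%N by rewrite (leq_trans (dvdp_leq p0 Dp)).
  have /dvdpP [Q PE] : D %| P by exact: dvdp_gcdl.
  have D0 : D != 0 by apply: contraNneq P0 => D0; rewrite PE D0 mulr0.
  have Q0 : Q != 0 by apply: contraNneq P0 => Q0; rewrite PE Q0 mul0r.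
  have sQ : (size Q <= e.+1)%N.
    have sD1 : (1 < size D)%N by rewrite ltn_neqAle eq_sym nPp size_poly_gt0.
    move: sP sD1; rewrite PE size_mul //; case: (size D) => [|[|n]] //.
    by rewrite !addnS /= => -[<-] _; rewrite leq_addr.
  by rewrite PE poly_symM // mulrDl !IHe // addr0.
move: sf sg; rewrite leq_eqVlt => /orP [/eqP sf|sf]; last first.
  rewrite leq_eqVlt => /orP [/eqP sg|sg]; last exact: IHe.
  by rewrite iso_milnorKC lower.
rewrite leq_eqVlt => /orP [/eqP sg|sg]; last exact: lower.
have f0 : f != 0 by rewrite -size_poly_gt0 sf.
have g0 : g != 0 by rewrite -size_poly_gt0 sg.
pose a := lead_coef f / lead_coef g; pose r := f - a *: g.
have a0 : a != 0 by rewrite mulf_neq0 ?invr_eq0 ?lead_coef_eq0.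
have sr : (size r <= e.+1)%N.
  apply/leq_sizeP => i; rewrite leq_eqVlt => /orP [/eqP <-|lt_i].
    have := lead_coefE f; have := lead_coefE g; rewrite sf sg /= => gE fE.
    by rewrite coefB coefZ -fE -gE /a divfK ?lead_coef_eq0 // subrr.
  by rewrite coefB coefZ !nth_default ?sf ?sg // mulr0 subr0.
have [r0|r0] := eqVneq r 0.
  have -> : f = a *: g by apply/eqP; rewrite -subr_eq0 -/r r0.
  by rewrite poly_symZ // poly_sym_sq.
have ag0 : a *: g != 0 by rewrite scaler_eq0 negb_or a0.
pose b p (p0 : p != 0) : nonzero F := exist _ (ev p) (evalx_neq0 p0).
(* In the relation for a g + r = f, the products with {r} vanish by [lower] and {f}{f} is a square,
   which leaves {g}{f}. *)
have : (poly_sym (a *: g) + poly_sym f) * (poly_sym r + poly_sym f) = 0.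
  rewrite (@poly_symE (a *: g) (b _ ag0)) // (@poly_symE f (b _ f0)) // (@poly_symE r (b _ r0)) //.
  rewrite -!(rmorphD iso) -(rmorphM iso) sym_steinbergD ?rmorph0 //=.
  by rewrite -evalxD /r addrC subrK.
by rewrite poly_symZ // mulrDl !mulrDr poly_sym_sq (lower g r) // (lower f r) // add0r !addr0 iso_milnorKC.
Qed.

(** Modulo 2 the symbol of p/q is {p} + {q}, which reduces to polynomials. *)
Lemma iso_sym_mul0 (a b : nonzero F) : iso_sym iota a * iso_sym iota b = 0.
Proof.
have num_den (c : nonzero F) : exists p q, iso_sym iota c = poly_sym p + poly_sym q.
  have [p [q [q0 cE]]] := ratF.2 (val c); exists p, q.
  have p0 : ev p != 0.
    by have := valP c; rewrite [X in X != 0]cE; apply: contraNneq => p0; rewrite -/(ev p) p0 mul0r.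
  pose sp : nonzero F := exist _ (ev p) p0; pose sq : nonzero F := exist _ (ev q) q0.
  rewrite (@poly_symE p sp) // (@poly_symE q sq) // -rmorphD /iso_sym; congr (iso _).
  have -> : sym sp = sym c + sym sq by apply: symM; rewrite [val c]cE /= divfK.
  by rewrite -addrA milnorK_add2 addr0.
have [p [q ->]] := num_den a; have [p' [q' ->]] := num_den b.
by rewrite mulrDl !mulrDr !poly_sym_mul0 !addr0.
Qed.

Lemma gen_deg_iso_sym (p : nat) (z : A) :
  (2 <= p)%N -> gen_deg (@iso_sym k F iota) p z -> z = 0.
Proof.
move=> p2; elim=> [//|_ [s [sp ->]]|y y' _ -> _ ->]; last exact: subrr.
case: s sp => [|a [|b s]] /=; rewrite ?big_cons; [lia|lia|].
by rewrite mulrA iso_sym_mul0 mul0r.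
Qed.
End Vanishing.

(** * The augmentation *)

Section Augmentation.
Variable F : fieldType.

(* The Milnor ring as a nonzero ring, over which polynomials are available. *)
Definition milnor_nzring : Type := milnorK F.
HB.instance Definition _ := GRing.PzRing.on milnor_nzring.
Fact milnor_nzring_oner_neq0 : (1 : milnor_nzring) != 0.
Proof. exact/eqP/milnorK1_neq0. Qed.
HB.instance Definition _ := GRing.PzSemiRing_isNonZero.Build milnor_nzring
  milnor_nzring_oner_neq0.

Lemma milnorK_aug : exists aug : {rmorphism milnorK F -> 'F_2}, forall a, aug (sym a) = 0.
Proof.
have F2 (c : 'F_2) : c + c = 0 by case: c => [[|[|?]] ?] //; apply: val_inj.
by have [|||aug augE] := @milnorK_lift F 'F_2 (fun=> 0); [| rewrite ?addr0 | rewrite ?mul0r | exists aug].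
Qed.

(* The grading of the Milnor ring is encoded by the ring morphism {a} |-> {a} t. *)
Lemma milnorK_unit_regular (aug : {rmorphism milnorK F -> 'F_2}) (y : milnorK F) s :
  (forall a, aug (sym a) = 0) -> aug y != 0 -> y * pure_symbol s = 0 ->
  pure_symbol s = 0.
Proof.
move=> augE.
have add2 (p : {poly milnor_nzring}) : p + p = 0.
  by apply/polyP => i; rewrite coefD coef0; exact: milnorK_add2.
have [|||phi phiE] := @milnorK_lift F {poly milnor_nzring}
  (fun a => (sym a : milnor_nzring)%:P * 'X).
- exact: add2.
- by move=> a b c /symM ->; rewrite -mulrDl -polyCD.
- move=> a b /sym_steinberg ab0.
  rewrite mulrA -[_%:P * _ * _]mulrA -commr_polyX mulrA -polyCM.
  by rewrite [X in X%:P]ab0 polyC0 !mul0r.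
have phi_pure t : phi (pure_symbol t) = (pure_symbol t : milnor_nzring)%:P * 'X^(size t).
  elim: t => [|a t IHt]; first by rewrite pure_symbol_nil rmorph1 mulr1.
  rewrite pure_symbol_cons rmorphM phiE IHt mulrA -[_%:P * _ * _]mulrA -commr_polyX mulrA.
  by rewrite -polyCM -mulrA -exprS.
(* The constant coefficient recovers the augmentation, since symbols of positive length go to
   multiples of the variable. *)
have phi0 z : (phi z)`_0 = if aug z == 0 then 0 else 1.
  elim/milnorK_ind: z => [|t z IHz]; first by rewrite !rmorph0 coef0 eqxx.
  rewrite !rmorphD coefD IHz phi_pure.
  case: t => [|a t] /=.
    rewrite pure_symbol_nil rmorph1 mulr1 coefC /=.
    case: (aug z) => [[|[|?]] ?] //=.
      by rewrite addr0.
    exact: milnorK_add2.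
  by rewrite pure_symbol_cons rmorphM augE mul0r add0r exprSr mulrA coefMX add0r.
(* With n the length of [s], the coefficient of degree n of phi(y) {s} t^n is {s}, as phi(y) has
   constant coefficient 1. *)
move=> y0 /(congr1 phi)/polyP/(_ (size s)).
by rewrite rmorphM phi_pure mulrA coefMXn ltnn subnn coefMC phi0 (negPf y0) mul1r rmorph0 coef0.
Qed.
End Augmentation.

(** An element of augmentation 1 annihilates no nonzero symbol of F, and nonzero symbols of k stay
    nonzero over F. *)
Lemma iso_milnorK_aug (k F : fieldType) (iota : {rmorphism k -> F}) (x : F) :
  is_rational_function_field iota x ->
  exists aug : {rmorphism iso_milnorK iota -> 'F_2}, forall a, aug (iso_sym iota a) = 0.
Proof.
move=> ratF; have [aug augE] := milnorK_aug F.
have [y [s [s0 ys]]|psi psiE] := @rquot_lift _ _ (killed iota) aug.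
  apply/eqP/negPn/negP => y0; apply: (pure_symbol_base_change ratF s0).
  exact: milnorK_unit_regular augE y0 ys.
by exists psi => a; rewrite psiE.
Qed.

(** * Koszulity of algebras with zero products *)

Lemma tensor_sum (U W : zmodType) (z : tensor U W) :
  exists s : seq (U * W), z = \sum_(p <- s) tens p.1 p.2.
Proof.
rewrite -[z]quot_reprK; elim/malg2_ind: (quot_repr z) => [|[u w] g [s sE]].
  by exists [::]; rewrite big_nil raddf0.
by exists ((u, w) :: s); rewrite big_cons -sE raddfD.
Qed.

Lemma tensor_alg_ind (V : zmodType) (P : tensor_alg V -> Prop) :
  P 0 -> (forall s z, P z -> P (word s + z)) -> forall z, P z.
Proof.
move=> P0 PD z; elim/to_rquot_ind: z => g.
elim/malg2_ind: g => [|m g IHg]; first by rewrite raddf0.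
rewrite raddfD; suff E : to_rquot (@additive_rel V) (mkmalgU m 1) = word (fmonom_val m).
  by rewrite [X in P (X + _)]E; apply: PD.
case: m => s /=; elim: s => [|a s IHs]; first by rewrite /word big_nil -fmoneE [LHS]rmorph1.
rewrite word_cons -IHs -rmorphM; congr (to_rquot _ _).
rewrite [RHS]malg_fmonomM; congr (mkmalgU _ _).
by apply/eqP; rewrite fmP fmM fmU.
Qed.

Lemma tgen0 (V : zmodType) : tgen (0 : V) = 0.
Proof. by apply: (addrI (tgen 0)); rewrite -tgenD !addr0. Qed.

Definition F2_scale (W : zmodType) (c : 'F_2) (w : W) : W := w *+ (c != 0).

(** [koszul] asks for a module over F_2, while the augmentation ideal is only a group of exponent 2;
    an equality of groups, rather than an isomorphism, lets constructions over one be transported to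
    the other. *)
Lemma F2_lmodule (W : zmodType) : (forall w : W, w + w = 0) ->
  exists V : lmodType 'F_2, (V : zmodType) = W.
Proof.
case: W => T cT W2; set W := GRing.Zmodule.Pack cT in W2 *; pose sc := @F2_scale W.
have F2P (c : 'F_2) : c = 0 \/ c = 1.
  by case: c => [[|[|?]] ?] //; [left|right]; apply: val_inj.
have scA a b v : sc a (sc b v) = sc (a * b) v.
  by case: (F2P a) => ->; case: (F2P b) => ->; rewrite /sc /F2_scale ?mul0r ?mul1r ?eqxx ?oner_eq0 ?mulr0n ?mulr1n ?mul0rn.
have sc1 : left_id 1 sc by move=> v; rewrite /sc /F2_scale oner_eq0.
have scDr : right_distributive sc +%R by move=> a v w; rewrite /sc /F2_scale mulrnDl.
have scDl v : {morph sc^~ v : a b / a + b}.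
  move=> a b; case: (F2P a) => ->; case: (F2P b) => ->; rewrite ?addr0 ?add0r //.
pose V : lmodType 'F_2 := HB.pack T cT (GRing.Zmodule_isLmodule.Build 'F_2 W scA sc1 scDr scDl).
exists V; rewrite {}/V.
case: cT @W W2 @sc F2P scA sc1 scDr scDl => *.
reflexivity.
Qed.

Section SquareZero.
Variables (A : pzRingType) (X : Type) (e : X -> A).
Variable augA : {rmorphism A -> 'F_2}.
Hypothesis A2 : forall a : A, a + a = 0.
Hypothesis e_mul0 : forall x y, e x * e y = 0.
Hypothesis augA_e : forall x, augA (e x) = 0.
Hypothesis A_gen : forall a, exists b : bool, gen_deg e 1 (a - b%:R).

Local Notation gr := (gen_deg e).
Local Notation W := (aug gr).

Let natb_add (B : pzRingType) (b c : bool) : (forall a : B, a + a = 0) ->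
  b%:R + c%:R = (b (+) c)%:R :> B.
Proof. by move=> B2; case: b; case: c; rewrite /= ?addr0 ?add0r. Qed.

Lemma deg1_ind (P : A -> Prop) :
  P 0 -> (forall x, P (e x)) -> (forall a b, P a -> P b -> P (a - b)) ->
  forall a, gr 1 a -> P a.
Proof.
move=> P0 Pe PB a; elim=> [//|_ [s [s1 ->]]|y z _ Py _ Pz]; last exact: PB.
by case: s s1 => [|y []] // _; rewrite big_seq1.
Qed.

Lemma deg1_mul0 a b : gr 1 a -> gr 1 b -> a * b = 0.
Proof.
move=> ga gb; move: a ga; apply: deg1_ind => [|x|a a' a0 a'0]; first exact: mul0r.
- move: b gb; apply: deg1_ind => [|y|b b' b0 b'0]; [exact: mulr0 | exact: e_mul0|].
  by rewrite mulrBr b0 b'0 subrr.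
- by rewrite mulrBl a0 a'0 subrr.
Qed.

Lemma deg1_aug a : gr 1 a -> augA a = 0.
Proof.
by move: a; apply: deg1_ind => [||y z y0 z0]; rewrite ?rmorph0 ?rmorphB ?y0 ?z0 ?subrr.
Qed.

Lemma deg_ge2 n a : gr n.+2 a -> a = 0.
Proof.
elim=> [//|_ [[|y [|z s]] [//= _ ->]]|y z _ -> _ ->]; last exact: subrr.
by rewrite !big_cons mulrA e_mul0 mul0r.
Qed.

Lemma deg0 a : gr 0 a -> exists b : bool, a = b%:R.
Proof.
elim=> [|_ [[|y s] [//= _ ->]]|y z _ [b ->] _ [c ->]].
- by exists false.
- by exists true; rewrite big_nil.
- exists (b (+) c); rewrite -natb_add //; congr (_ + _).
  by apply/eqP; rewrite eq_sym -addr_eq0 A2.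
Qed.

(** As A = F_2 + A_1 with A_1 A_1 = 0, multiplying A_1 by A on either side stays in A_1. *)
Lemma aug_ideal_deg1 a :
  ideal (fun a : A => exists2 n, (0 < n)%N & gr n a) a -> gr 1 a.
Proof.
have sgl b c : gr 1 c -> gr 1 (b * c) /\ gr 1 (c * b).
  move=> gc; have [t gt] := A_gen b.
  have -> : b = (b - t%:R) + t%:R by rewrite subrK.
  rewrite mulrDl mulrDr (deg1_mul0 gt gc) (deg1_mul0 gc gt) !add0r.
  by case: (t); rewrite ?mul1r ?mulr1 ?mul0r ?mulr0; split=> //; exact: zspan0.
elim=> [|_ [b [s [c [[n n0 gs] ->]]]]|y z _ gy _ gz]; [exact: zspan0| |exact: zspanB].
have gs1 : gr 1 s by case: n n0 gs => [|[|n]] // _ /deg_ge2 ->; exact: zspan0.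
by apply: (sgl c _ _).2; apply: (sgl b _ _).1.
Qed.

Lemma aug_val_deg1 (w : W) : gr 1 (aug_val w).
Proof. by apply: aug_ideal_deg1; apply/span_predP/(valP w). Qed.

Lemma deg1_aug_val a : gr 1 a -> exists w : W, aug_val w = a.
Proof.
move=> ga.
have aP : a \in span_pred (ideal_gens (fun a : A => exists2 n, (0 < n)%N & gr n a)).
  by apply/span_predP/zspan_gen; exists 1, a, 1; rewrite mul1r mulr1; split=> //; exists 1%N.
by exists (exist _ a aP).
Qed.

Lemma aug_add2 (w : W) : w + w = 0.
Proof. by apply: val_inj; rewrite raddfD; exact: A2. Qed.

Lemma aug_mul0 (v w : W) : aug_mul v w = 0.
Proof. by apply: val_inj; exact: deg1_mul0 (aug_val_deg1 v) (aug_val_deg1 w). Qed.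

(** Each term of the differential multiplies two neighbouring letters, and such products vanish. *)
Lemma bar_d_eq0 (z : bar gr) : bar_d z = 0.
Proof.
elim/tensor_alg_ind: z => [|s z IHz]; first exact: raddf0.
have -> : bar_d (word s + z) = bar_d (word s) + bar_d z by exact: raddfD.
rewrite IHz addr0 bar_dE; elim: s => [//|a [//|b s] IHs].
by rewrite bar_d_word_cons2 IHs mulr0 addr0 aug_mul0 word_cons tgen0 mul0r.
Qed.

Local Notation R2 := (gen_deg (@tgen W) 2).

Lemma quadratic_relations_deg2 : quadratic_relations R2.
Proof. by split=> //; [exact: zspan0 | exact: zspanB]. Qed.

Lemma qgenD (v w : W) : qgen R2 (v + w) = qgen R2 v + qgen R2 w.
Proof. by rewrite /qgen tgenD rmorphD. Qed.

Lemma quadratic_alg_add2 (z : quadratic_alg R2) : z + z = 0.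
Proof. by elim/to_rquot_ind: z => t; rewrite -rmorphD tensor_alg_add2 rmorph0. Qed.

Lemma quadratic_alg_sum (z : quadratic_alg R2) :
  exists (b : bool) (v : W), z = b%:R + qgen R2 v.
Proof.
elim/to_rquot_ind: z => t; elim/tensor_alg_ind: t => [|s z [b [v IH]]].
  by exists false, 0; rewrite add0r /qgen tgen0.
rewrite rmorphD IH; case: s => [|u [|w s]].
- exists (true (+) b), v; rewrite addrA -(natb_add true b quadratic_alg_add2).
  by rewrite /word big_nil rmorph1.
- exists b, (u + v); rewrite qgenD addrCA; congr (_ + (_ + _)).
  by rewrite /word big_seq1.
- exists b, v; rewrite !word_cons mulrA (_ : to_rquot _ _ = 0) ?add0r //.
  apply/to_rquot_eq0/zspan_gen; exists 1, (tgen u * tgen w), (word s).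
  rewrite mul1r; split=> //; apply: zspan_gen; exists [:: u; w].
  by rewrite !big_cons big_nil mulr1.
Qed.

Lemma quadratic_alg_iso : exists2 phi : {rmorphism quadratic_alg R2 -> A}, bijective phi &
  forall n x, gen_deg (@qgen W R2) n x <-> gr n (phi x).
Proof.
have augD : {morph @aug_val _ gr : v w / v + w} by move=> v w; rewrite /aug_val raddfD.
have [phi0 phi0E] := tensor_alg_ring_lift A2 augD.
have [|phi phiE] := @rquot_lift _ _ R2 phi0.
  move=> r; elim=> [|_ [[|u [|v [|w s]]] [//= _ ->]]|y z _ y0 _ z0]; first exact: rmorph0.
    rewrite !big_cons big_nil mulr1 rmorphM !phi0E.
    exact: deg1_mul0 (aug_val_deg1 u) (aug_val_deg1 v).
  by rewrite rmorphB y0 z0 subrr.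
have phi_gen v : phi (qgen R2 v) = aug_val v by rewrite /qgen phiE phi0E.
(* The augmentation isolates the F_2-component, which yields the injectivity of [phi]. *)
have aug_nat (b : bool) (a : A) : gr 1 a -> augA (b%:R + a) = b%:R.
  by move=> ga; rewrite rmorphD (deg1_aug ga) addr0 rmorph_nat.
have phi_eq0 z : phi z = 0 -> z = 0.
  have [b [v ->]] := quadratic_alg_sum z; rewrite rmorphD rmorph_nat phi_gen => z0.
  have := aug_nat b _ (aug_val_deg1 v); rewrite z0 rmorph0.
  case: b z0 => [_ /esym/eqP|]; first by rewrite oner_eq0.
  rewrite add0r => v0 _; have -> : v = 0 by exact: val_inj.
  by rewrite add0r /qgen tgen0 rmorph0.
have phi_inj : injective phi.
  by move=> y z yz; apply/eqP; rewrite -subr_eq0; apply/eqP/phi_eq0; rewrite rmorphB yz subrr.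
have phi_surj a : exists z, phi z = a.
  have [b /deg1_aug_val [w wE]] := A_gen a.
  by exists (b%:R + qgen R2 w); rewrite rmorphD rmorph_nat phi_gen wE subrKC.
have [psi psiK] := choice phi_surj.
exists phi; first by exists psi => // z; apply: phi_inj; rewrite psiK.
move=> n z; split.
  elim=> [|_ [s [sn ->]]|y w _ gy _ gw].
  - by rewrite rmorph0; exact: zspan0.
  - rewrite rmorph_prod (eq_bigr _ (fun v _ => phi_gen v)).
    case: s sn => [|u [|v s]] /= <-; rewrite ?big_nil ?big_seq1.
    + by apply: zspan_gen; exists [::]; rewrite big_nil.
    + exact: aug_val_deg1.
    + rewrite !big_cons mulrA (deg1_mul0 (aug_val_deg1 u) (aug_val_deg1 v)) mul0r.
      exact: zspan0.
  - by rewrite rmorphB; exact: zspanB.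
case: n => [|[|n]].
- case/deg0 => b zb; have -> : z = b%:R by apply: phi_inj; rewrite zb rmorph_nat.
  case: b {zb}; last exact: zspan0.
  by apply: zspan_gen; exists [::]; rewrite big_nil.
- case/deg1_aug_val => w wE; have -> : z = qgen R2 w by apply: phi_inj; rewrite phi_gen wE.
  by apply: zspan_gen; exists [:: w]; rewrite big_seq1.
- by move/deg_ge2/phi_eq0 => ->; exact: zspan0.
Qed.

(** The relations are the whole tensor square, so any two consecutive letters form one: the word is
    cut before and after them. *)
Lemma koszul_dual_deg_word (s : seq W) : koszul_dual_deg R2 (size s) (word s).
Proof.
split; first by apply: zspan_gen; exists s.
move=> i j ijs; apply: zspan_gen.
exists (word (take i s)), (word (take 2 (drop i s))), (word (drop 2 (drop i s))).
have gw n t : size t = n -> gen_deg (@tgen W) n (word t).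
  by move=> <-; apply: zspan_gen; exists t.
split.
- by apply: gw; rewrite size_takel // -ijs -addnA leq_addr.
- by apply: gw; rewrite size_takel // size_drop -ijs; lia.
- by apply: gw; rewrite !size_drop -ijs; lia.
- by rewrite -mulrA -!word_cat !cat_take_drop.
Qed.

Lemma koszul_dual_all (z : tensor_alg W) :
  z \in span_pred (fun z => exists n, koszul_dual_deg R2 n z).
Proof.
apply/span_predP; elim/tensor_alg_ind: z => [|s z IHz]; first exact: zspan0.
rewrite -[z]opprK; apply: zspanB; last by rewrite -sub0r; apply: zspanB => //; exact: zspan0.
by apply: zspan_gen; exists (size s); exact: koszul_dual_deg_word.
Qed.

Lemma bar_cycle_all (z : bar gr) : z \in span_pred (fun z : bar gr => bar_d z = 0).
Proof. exact/span_predP/zspan_gen/bar_d_eq0. Qed.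

Lemma koszul_coalgebra_iso :
  exists f : {additive koszul_dual R2 -> Tor gr}, is_coalgebra_iso f.
Proof.
pose cyc z : bar_cycles gr := exist _ z (bar_cycle_all z).
pose kd z : koszul_dual R2 := exist _ z (koszul_dual_all z).
pose f (c : koszul_dual R2) : Tor gr := Tor_class (cyc (kd_val c)).
have fB : zmod_morphism f.
  move=> c c'; rewrite /f /Tor_class -raddfB; congr (to_quot _ _).
  by apply: val_inj; rewrite /= /kd_val !raddfB.
pose fA : {additive koszul_dual R2 -> Tor gr} :=
  HB.pack f (GRing.isZmodMorphism.Build _ _ f fB).
(* Only 0 is a boundary, so a class has a single representing cycle. *)
have Tor_inj (y z : bar_cycles gr) : Tor_class y = Tor_class z -> cycle_val y = cycle_val z.
  move=> yz; apply/eqP; rewrite -subr_eq0; apply/eqP.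
  have /Tor_class_eq0 [w] : Tor_class (y - z) = 0.
    by rewrite /Tor_class raddfB -/(Tor_class y) yz subrr.
  by rewrite bar_d_eq0 /cycle_val raddfB.
have f_repr c : Tor_repr (f c) = kd_val c.
  by rewrite /Tor_repr (Tor_inj _ (cyc (kd_val c))) // /Tor_class quot_reprK.
exists fA; split.
- exists (fun y => kd (Tor_repr y)) => [c|y].
    by apply: val_inj; rewrite /= f_repr.
  by rewrite /= /f /Tor_class -[RHS]quot_reprK; congr (to_quot _ _); exact: val_inj.
- by move=> n c [gc _]; exists (cyc (kd_val c)).
- move=> c; have [s sE] := tensor_sum (deconc (kd_val c)).
  exists [seq (kd p.1, kd p.2) | p <- s]; first by rewrite /koszul_dual_comul sE big_map.
  (* Both comultiplications are deconcatenation, so the boundary term is 0. *)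
  exists 0; rewrite /= f_repr -map_comp big_map sE.
  have -> : bar_d2 (0 : tensor (bar gr) (bar gr)) = 0.
    by have := @bar_d2_zmod_morphism _ gr 0 0; rewrite !subrr.
  by rewrite addr0; apply: eq_bigr => p _; rewrite /= !f_repr.
Qed.

Lemma koszul_square_zero : koszul gr.
Proof.
have main (U : zmodType) : U = W -> exists R : tensor_alg U -> Prop,
    [/\ quadratic_relations R,
        exists2 phi : {rmorphism quadratic_alg R -> A}, bijective phi &
          forall n x, gen_deg (@qgen U R) n x <-> gr n (phi x) &
        exists f : {additive koszul_dual R -> Tor gr}, is_coalgebra_iso f].
  move=> ->; exists R2; split; [exact: quadratic_relations_deg2 |
    exact: quadratic_alg_iso | exact: koszul_coalgebra_iso].
have [V /main VE] := F2_lmodule aug_add2.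
by exists V.
Qed.
End SquareZero.

Theorem corollary6p7 (k F : fieldType) (iota : {rmorphism k -> F}) (x : F) :
  flexible k ->
  2%N \notin [pchar k] ->
  is_rational_function_field iota x ->
  (forall (p : nat) (z : iso_milnorK iota),
     (2 <= p)%N -> gen_deg (@iso_sym k F iota) p z -> z = 0) /\
  koszul (gen_deg (@iso_sym k F iota)).
Proof.
move=> flex_k char_k ratF.
have two0 : 2%:R != 0 :> k by apply: contra char_k => /eqP two0; rewrite inE /= two0 eqxx.
have mul0 := iso_sym_mul0 flex_k two0 ratF.
split=> [p z|]; first exact: gen_deg_iso_sym flex_k two0 ratF p z.
have [aug augE] := iso_milnorK_aug ratF.
(* What remains is A = F_2 + A_1: the empty symbol changes b, a symbol of length 1 lies in A_1, and
   longer ones vanish. *)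
apply: (koszul_square_zero (iso_milnorK_add2 (iota := iota)) mul0 augE) => a.
elim/to_rquot_ind: a => y; elim/milnorK_ind: y => [|s y].
  by exists false; rewrite rmorph0 subr0; exact: zspan0.
case=> b IH; have add2 := iso_milnorK_add2 (iota := iota).
have opp (z : iso_milnorK iota) : - z = z.
  by apply/eqP; rewrite eq_sym -addr_eq0 add2.
rewrite rmorphD; case: s => [|c [|d s]].
- exists (~~ b); move: IH; rewrite pure_symbol_nil rmorph1 !opp.
  by case: b; rewrite /= ?addr0 addrC // addrA add2 add0r.
- exists b; rewrite -addrA pure_symbol_cons pure_symbol_nil mulr1.
  rewrite -[to_rquot _ (sym c)]opp addrC; apply: zspanB => //.
  by apply: zspan_gen; exists [:: c]; rewrite big_seq1.
- exists b; rewrite !pure_symbol_cons mulrA rmorphM (rmorphM _ (sym c)).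
  by rewrite [X in X * _]mul0 mul0r add0r.
Qed.
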